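(* Let $\{\alpha_i\}_{i\in\mathbb{N}_0}\subset[0,\infty)$ with $0=\alpha_0<\alpha_1<\alpha_2<\dots$ and $\sum_{i\in\mathbb{N}}\frac{1}{\alpha_i}=\infty$. Let $\mathcal{F}=\{x^{\alpha_i}\}_{i\in\mathbb{N}_0}$, considered on $[0,1]$, and let $L:\operatorname{lin}\mathcal{F}\to\mathbb{R}$ be a linear functional. The following are equivalent: (i) $L$ is a $[0,1]$-moment functional. (ii) $L(p)\ge 0$ holds for all $p\in\operatorname{lin}\mathcal{F}$ with $p\ge 0$ on $[0,1]$. (iii) $L(p)\ge 0$ holds for all $p\in\operatorname{lin}\mathcal{F}$ with $p>0$ on $[0,1]$. (iv) $L(p)\ge 0$ holds for each of the following four kinds of $p$: $$p(x)=\det\begin{pmatrix} 1&x^{\alpha_1}&x^{\alpha_2}&\dots&x^{\alpha_{2m-1}}&x^{\alpha_{2m}}\\ x&(x_1&x_1)&\dots&(x_m&x_m)\end{pmatrix},$$ $$p(x)=\det\begin{pmatrix} x^{\alpha_1}&x^{\alpha_2}&x^{\alpha_3}&\dots&x^{\alpha_{2m-2}}&x^{\alpha_{2m-1}}&x^{\alpha_{2m}}\\ x&(x_1&x_1)&\dots&(x_{m-1}&x_{m-1})&1\end{pmatrix},$$ $$p(x)=\det\begin{pmatrix} x^{\alpha_1}&x^{\alpha_2}&x^{\alpha_3}&\dots&x^{\alpha_{2m}}&x^{\alpha_{2m+1}}\\ x&(x_1&x_1)&\dots&(x_m&x_m)\end{pmatrix},$$ $$p(x)=\det\begin{pmatrix}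 1&x^{\alpha_1}&x^{\alpha_2}&\dots&x^{\alpha_{2m-1}}&x^{\alpha_{2m}}&x^{\alpha_{2m+1}}\\ x&(x_1&x_1)&\dots&(x_m&x_m)&1\end{pmatrix},$$ for all $m\in\mathbb{N}$ and all $0<x_1<x_2<\dots<x_m<1$.
   Context: $\mathbb{N}=\{1,2,\dots\}$, $\mathbb{N}_0=\mathbb{N}\cup\{0\}$. $\operatorname{lin}\mathcal{F}$ is the real vector space of finite linear combinations of the functions in $\mathcal{F}$; $x^0=1$ is the constant function, and $0^\alpha=0$ for $\alpha>0$. $L$ is a $[0,1]$-moment functional if there is a (positive) measure $\mu$ on $[0,1]$ with $L(f)=\int_0^1 f\,d\mu$ for all $f\in\operatorname{lin}\mathcal{F}$. Matrix notation: for functions $g_0,\dots,g_k$ and points $z_0,\dots,z_k$, $\begin{pmatrix} g_0&\dots&g_k\\ z_0&\dots&z_k\end{pmatrix}$ denotes the $(k+1)\times(k+1)$ matrix whose row belonging to the point $z_j$ is $(g_0(z_j),\dots,g_k(z_j))$. A bracketed pair $(z\ \ z)$ in the bottom line stands for two consecutive rows: $(g_0(z),\dots,g_k(z))$ followed by the row of derivatives $(g_0'(z),\dots,g_k'(z))$. In the top line $x^{\alpha_i}$ denotes the function $t\mapsto t^{\alpha_i}$; the bottom-line entry $x$ is the variable of $p$. *)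

(* Defs.v *)
From HB Require Import structures.
From mathcomp Require Import all_boot all_order all_algebra.
From mathcomp Require Import all_classical all_reals all_analysis.

Set Implicit Arguments.
Unset Strict Implicit.
Unset Printing Implicit Defensive.

Import Order.TTheory GRing.Theory Num.Theory.
Import numFieldNormedType.Exports.

Local Open Scope classical_set_scope.
Local Open Scope ring_scope.

Definition lin (R : realType) (F : set (R -> R)) : {pred (R -> R)} :=
  fun f => `[< exists (n : nat) (c : 'I_n -> R) (g : 'I_n -> (R -> R)),
    (forall i, F (g i)) /\ f = \sum_(i < n) c i *: g i >].

Lemma lin_submod_closed (R : realType) (F : set (R -> R)) :
  submod_closed (lin F).
Proof.
split.
  by apply/asboolP; exists 0%N, (fun=> 0), (fun=> 0); split=> [[]//|]; rewrite big_ord0.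
move=> a u v /asboolP[n [c [g [Fg ->]]]] /asboolP[m [d [h [Fh ->]]]].
apply/asboolP; exists (n + m)%N.
exists (fun i => match fintype.split i with inl j => a * c j | inr j => d j end).
exists (fun i => match fintype.split i with inl j => g j | inr j => h j end).
split=> [i|]; first by case: fintype.split.
rewrite big_split_ord /= scaler_sumr; congr (_ + _); apply: eq_bigr => i _.
  by rewrite scalerA (unsplitK (inl i)).
by rewrite (unsplitK (inr i)).
Qed.

HB.instance Definition _ (R : realType) (F : set (R -> R)) :=
  GRing.isSubmodClosed.Build R (R -> R) (lin F) (lin_submod_closed F).

Record linType (R : realType) (F : set (R -> R)) :=
  LinType { lin_fun :> R -> R ; lin_funP : lin_fun \in lin F }.

HB.instance Definition _ (R : realType) (F : set (R -> R)) :=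
  [isSub for @lin_fun R F].
HB.instance Definition _ (R : realType) (F : set (R -> R)) :=
  [Choice of linType F by <:].
HB.instance Definition _ (R : realType) (F : set (R -> R)) :=
  [SubChoice_isSubLmodule of linType F by <:].

(* Functions on [0, 1] are encoded as functions on R that vanish outside of
   [0, 1], so that two of them are equal iff they agree on [0, 1].
   Note that 0 `^ 0 = 1 and 0 `^ a = 0 for a != 0. *)
Definition power_system (R : realType) (alpha : nat -> R) : set (R -> R) :=
  range (fun i => ((fun t : R => t `^ alpha i) \_ `[0, 1])%FUN).

(* A measure on [0, 1] is encoded by a Borel measure on R of which only the
   restriction to [0, 1] is used. No integrability is lost in using the
   extended integral: if 1 belongs to F, the equation for f = 1 makes mu finite
   on [0, 1]. *)
Definition moment_functional (R : realType) (F : set (R -> R))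
    (L : linType F -> R) : Prop :=
  exists mu : {measure set (measurableTypeR R) -> \bar R},
    forall f : linType F,
      (\int[mu]_(x in `[0%R, 1%R]) (f x)%:E)%E = (L f)%:E.

(* The bottom line of the matrix notation is encoded by the sequence of its
   rows, a row being a functional g |-> entry in the column of g: a single
   point z gives the row [pt z] and a bracketed pair (z z) the two rows
   [dbl z]. *)
Definition pt (R : realType) (z : R) : seq ((R -> R) -> R) :=
  [:: fun g => g z].

Definition dbl (R : realType) (z : R) : seq ((R -> R) -> R) :=
  [:: fun g => g z; fun g => derive1 g z].

Definition node_mx (R : realType) (n : nat) (g : nat -> R -> R)
    (rows : seq ((R -> R) -> R)) : 'M[R]_n :=
  \matrix_(i < n, j < n) nth (fun=> 0) rows i (g j).

Lemma det_node_mx_lin (R : realType) (alpha : nat -> R) (k n : nat)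
    (rows : seq ((R -> R) -> R)) :
  exists p : linType (power_system alpha), {in `[0, 1], forall x,
    p x = \det (node_mx n.+1 (fun i t => t `^ alpha (k + i)%N)
                  (pt x ++ rows))}.
Proof.
pose M x := node_mx n.+1 (fun i t => t `^ alpha (k + i)%N) (pt x ++ rows).
pose g (j : 'I_n.+1) := ((fun t : R => t `^ alpha (k + j)%N) \_ `[0, 1])%FUN.
pose f : R -> R := \sum_j cofactor (M 0) ord0 j *: g j.
have fP : f \in lin (power_system alpha).
  by apply/asboolP; exists n.+1, (cofactor (M 0) ord0), g; split=> // j; exists (k + j)%N.
exists (LinType fP) => x x01 /=.
rewrite (expand_det_row _ ord0) /f fct_sumE; apply: eq_bigr => j _.
have -> : cofactor (M 0) ord0 j = cofactor (M x) ord0 j.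
  rewrite /cofactor; congr (_ * \det _); apply/matrixP => i l.
  by rewrite !mxE.
rewrite mxE /= mulrC; congr (_ * _).
by rewrite /g patchE mem_setE x01.
Qed.

(* Main.v *)
Require Import Defs.
From HB Require Import structures.
From mathcomp Require Import all_boot all_order all_algebra.
From mathcomp Require Import all_classical all_reals all_analysis.
From mathcomp Require Import perm measurable_realfun ring lra zify.

Set Implicit Arguments.
Unset Strict Implicit.
Unset Printing Implicit Defensive.

Import Order.TTheory GRing.Theory Num.Theory.
Import numFieldNormedType.Exports.

Local Open Scope classical_set_scope.
Local Open Scope ring_scope.

(** The content of the theorem is that (iv) forces (i); the other implications
are elementary once the four kinds of determinants are known to be nonnegative.

The powers [x ^ alpha i] form a Chebyshev system on the open half-line: by Rolle's
theorem a nontrivial combination of [N] of them has at most [N - 1] positive zeros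
counted with multiplicity up to two ([gpoly_zeros]). Consequently the determinants
with ordered nodes, single or doubled, are positive ([node_det_gt0]). Moving the
row of the variable past a doubled node is an even permutation of the rows, so the
determinants in (iv) are nonnegative on the unit interval; as (iii) extends to
nonnegative [p] by adding a small constant, this gives (iii) => (iv).

For (iv) => (ii), fix the span of the first [2m + 1] powers and let [E] be the sum of
the values at [2m + 1] sample points of the open interval. If [L] were negative on
some nonnegative element, the minimum [r < 0] of [L] over the compact set of
nonnegative elements with [E = 1] would be attained at some [q], and [M = L - r E]
would be nonnegative on nonnegative elements with [M q = 0]. Counting double zeros
inside and single zeros at the end points, [q] has at most [2m] zeros, so its zeros
are among those of a determinant [d] of the first or the second kind. Compactness
gives [d <= e + K q] for every [e > 0] and some [K], whence [M d <= 0], and then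
[L d = M d + r E d < 0], which contradicts (iv). This is [psd_of_supporting] and
[psd_of_determinants].

For (ii) => (i), Zorn's lemma extends [L] to a positive functional on all bounded
functions ([positive_extension]). Its values on the indicators of [x > a] form a tail
function, the quantile function of which pushes Lebesgue measure forward to a
measure with the same tails up to atoms ([quantile_measure]). A power with positive
exponent is increasing on the unit interval and therefore a uniform limit of
averages of such indicators, so its integral and the value of [L] agree
([psd_moment]). *)

(** * Zeros of generalized polynomials *)

Section Powers.
Variable R : realType.

Definition gpoly (N : nat) (b c : nat -> R) (x : R) : R :=
  \sum_(j < N) c j * x `^ b j.

(** Coefficients of the image of [gpoly N b c] under [x d/dx]: unlike the plain
derivative, this operator keeps the exponents. *)
Definition euler_coef (b c : nat -> R) : nat -> R := fun j => c j * b j.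

Lemma gpoly_is_derive N b c (x : R) : 0 < x ->
  is_derive x 1 (gpoly N b c) (gpoly N b (euler_coef b c) x / x).
Proof.
move=> x0.
have -> : gpoly N b c = \sum_(j < N) (c j \*: (@powR R ^~ (b j))).
  by apply/funext => t; rewrite fct_sumE.
have -> : gpoly N b (euler_coef b c) x / x =
    \sum_(j < N) (c j *: (b j * x `^ (b j - 1))).
  rewrite /gpoly mulr_suml; apply: eq_bigr => j _.
  have -> : x `^ (b j - 1) = x `^ b j / x.
    by rewrite powRB ?powRr1 ?(ltW x0)// (gt_eqF x0) implybT.
  by rewrite /euler_coef /GRing.scale /= !mulrA.
by apply: is_derive_sum => j; apply: is_deriveZ; exact: is_derive1_powR.
Qed.

Lemma gpoly_shift N b c (a x : R) : 0 < x ->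
  gpoly N (fun j => b j - a) c x = gpoly N b c x / x `^ a.
Proof.
move=> x0; rewrite /gpoly mulr_suml; apply: eq_bigr => j _.
by rewrite powRB ?mulrA// (gt_eqF x0) implybT.
Qed.

Lemma gpoly_recl N b c x : gpoly N.+1 b c x =
  c 0%N * x `^ b 0%N + gpoly N (b \o succn) (c \o succn) x.
Proof. by rewrite /gpoly big_ord_recl. Qed.

Lemma gpoly_eq0 N b c x : (forall j, (j < N)%N -> c j = 0) -> gpoly N b c x = 0.
Proof. by move=> c0; rewrite /gpoly big1// => j _; rewrite c0 ?mul0r. Qed.

Implicit Types f : R -> R.

(** In a list of nodes the flag [true] marks a double node; [mult] counts nodes with
multiplicity. *)
Definition mult (s : seq (R * bool)) : nat := sumn [seq (nat_of_bool zb.2).+1 | zb <- s].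

(** Rolle's theorem loses one zero in total: a zero of [f'] lies strictly between two
consecutive nodes, and each double node is itself a zero of [f']. The double node
[z0], if it is one, is left out of [s'], which keeps [path] strict and makes the
induction on the list go through. *)
Lemma rolle_nodes f f' (z0 : R) (b0 : bool) (s : seq (R * bool)) :
    (forall x : R, 0 < x -> is_derive x 1 f (f' x)) -> 0 < z0 ->
    path <%R z0 (unzip1 s) -> f z0 = 0 ->
    {in s, forall zb : R * bool, f zb.1 = 0 /\ (zb.2 -> f' zb.1 = 0)} ->
  exists s', [/\ path <%R z0 s', {in s', forall z, f' z = 0} &
    ((size s' + b0).+1 = mult ((z0, b0) :: s))%N].
Proof.
move=> fD; elim: s z0 b0 => [|[z1 b1] s IH] z0 b0 z0_gt0 /=.
  by move=> _ _ _; exists [::]; split=> //; rewrite /mult /= addn0.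
move=> /andP[z01 pz1] fz0 sz.
have [fz1 f'z1] := sz (z1, b1) (mem_head _ _).
have [s' [ps' s'0 szs']] := IH z1 b1 (lt_trans z0_gt0 z01) pz1 fz1
  (fun zb zbs => sz zb (@mem_behead _ (_ :: _) _ zbs)).
have x_gt0 x : z0 <= x -> 0 < x by exact: lt_le_trans.
have [x|||x x01 [_ fx]] := @Rolle R f z0 z1 z01.
- rewrite in_itv /= => /andP[z0x _].
  by have [] := fD x (x_gt0 _ (ltW z0x)).
- apply: derivable_within_continuous => x; rewrite in_itv /= => /andP[z0x _].
  by have [] := fD x (x_gt0 _ z0x).
- by rewrite fz0 fz1.
move: x01; rewrite in_itv /= => /andP[z0x xz1].
have f'x : f' x = 0.
  by have [_ <-] := fD x (x_gt0 x (ltW z0x)).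
exists (x :: (if b1 then z1 :: s' else s')); split.
- case: ifP => _ /=; first by rewrite z0x xz1.
  rewrite z0x /=; case: s' ps' {s'0 szs'} => //= y s' /andP[z1y ->].
  by rewrite (lt_trans xz1).
- move=> y; rewrite inE => /predU1P[->//|].
  case: ifP => [b1T|_]; last exact: s'0.
  by rewrite inE => /predU1P[->|/s'0//]; exact: f'z1.
- have -> : mult [:: (z0, b0), (z1, b1) & s] = (b0.+1 + mult ((z1, b1) :: s))%N by [].
  rewrite -szs'; case: (b1) => /=; rewrite ?addn0 ?addn1 addSn addnC; lia.
Qed.

(** Dividing by the power of lowest exponent turns the first term into a constant,
which differentiation removes; by Rolle's theorem one term costs at most one zero,
so [N] terms cannot have [N] zeros. Zeros of the derivative are only needed as
simple ones. *)
Lemma gpoly_zeros N b c (s : seq (R * bool)) :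
    {homo b : i j / (i < j)%N >-> i < j} ->
    sorted <%R (unzip1 s) -> {in s, forall zb : R * bool, 0 < zb.1} ->
    {in s, forall zb : R * bool, gpoly N b c zb.1 = 0 /\
                     (zb.2 -> gpoly N b (euler_coef b c) zb.1 = 0)} ->
    (N <= mult s)%N ->
  forall j, (j < N)%N -> c j = 0.
Proof.
elim: N b c s => // N IH b c [|[z0 b0] s] b_lt //= ps s_gt0 s0 Nmult.
have z0_gt0 : 0 < z0 by exact: (s_gt0 (z0, b0) (mem_head _ _)).
pose b' j := b j - b 0%N.
pose f := gpoly N.+1 b' c.
have feq (x : R) : 0 < x -> f x = gpoly N.+1 b c x / x `^ b 0%N.
  by move=> x0; rewrite /f gpoly_shift.
pose g := gpoly N (b' \o succn) (euler_coef b' c \o succn).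
have fE x : gpoly N.+1 b' (euler_coef b' c) x = g x.
  by rewrite gpoly_recl /euler_coef /b' subrr mulr0 mul0r add0r.
have gE (x : R) : 0 < x -> g x =
    (gpoly N.+1 b (euler_coef b c) x - b 0%N * gpoly N.+1 b c x) / x `^ b 0%N.
  move=> x0; rewrite -fE gpoly_shift//; congr (_ / _).
  rewrite /gpoly mulr_sumr -sumrB; apply: eq_bigr => j _.
  by rewrite /euler_coef /b'; ring.
have fs zb : zb \in (z0, b0) :: s ->
    f zb.1 = 0 /\ (zb.2 -> g zb.1 / zb.1 = 0).
  move=> zbs; have [g0 g'0] := s0 _ zbs; have zb0 := s_gt0 _ zbs.
  rewrite feq// g0 mul0r; split=> // /g'0 g'z.
  by rewrite gE// g'z g0 mulr0 subrr !mul0r.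
have fD (x : R) : 0 < x -> is_derive x 1 f (g x / x).
  by move=> x0; rewrite -fE; exact: gpoly_is_derive.
have [s' [ps' s'0 szs']] := rolle_nodes b0 fD z0_gt0 ps
  (proj1 (fs _ (mem_head _ _))) (fun zb zbs => fs zb (@mem_behead _ (_ :: _) _ zbs)).
have s'_gt0 : {in s', forall z, 0 < z}.
  move=> z zs'; apply: (lt_trans z0_gt0).
  by move: ps'; rewrite (path_sortedE lt_trans) => /andP[/allP/(_ _ zs')].
(* [rolle_nodes] does not count a double first node among the zeros. *)
pose s1 := if b0 then z0 :: s' else s'.
have s1_gt0 : {in s1, forall z, 0 < z}.
  move=> z; rewrite /s1; case: ifP => _; last exact: s'_gt0.
  by rewrite inE => /predU1P[->//|]; exact: s'_gt0.
have s10 : {in s1, forall z, g z = 0}.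
  move=> z zs1; have z_gt0 := s1_gt0 z zs1.
  suff : g z / z = 0.
    by move=> /eqP; rewrite mulf_eq0 invr_eq0 (gt_eqF z_gt0) orbF => /eqP.
  move: zs1; rewrite /s1; case: ifP => [b0T|_]; last exact: s'0.
  rewrite inE => /predU1P[->|]; last exact: s'0.
  by have [_] := fs _ (mem_head _ _); apply.
have c0 j : (j < N)%N -> c j.+1 = 0.
  have unz1 : unzip1 [seq (z, false) | z <- s1] = s1.
    by rewrite /unzip1 -map_comp map_id.
  move=> jN; have : (euler_coef b' c \o succn) j = 0.
    apply: (IH (b' \o succn) _ [seq (z, false) | z <- s1]) => //.
    - by move=> i k ik /=; rewrite /b' ltrD2r b_lt.
    - rewrite unz1 /s1; case: ifP => // _.
      exact: path_sorted ps'.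
    - by move=> _ /mapP[z zs1 ->]; exact: s1_gt0.
    - by move=> _ /mapP[z zs1 ->] /=; split=> //; exact: s10.
    have -> : mult [seq (z, false) | z <- s1] = size s1.
      by rewrite /mult; elim: (s1) => //= ? ? ->.
    move: Nmult; rewrite -[X in (_ <= X)%N -> _]szs' ltnS => /leq_trans; apply.
    by rewrite /s1; case: ifP => _; rewrite ?addn0 ?addn1.
  rewrite /= /euler_coef => /eqP; rewrite mulf_eq0 /b' subr_eq0 => /orP[/eqP//|].
  by rewrite gt_eqF// b_lt.
case=> [_|j]; last by rewrite ltnS; exact: c0.
have [/eqP + _] := s0 _ (mem_head _ _).
rewrite gpoly_recl gpoly_eq0 => [|j /c0//]; rewrite addr0 mulf_eq0.
by rewrite (gt_eqF (powR_gt0 _ z0_gt0)) orbF => /eqP.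
Qed.

End Powers.

(** * Positivity of determinants with ordered nodes *)

Section DerivativeSign.
Variable R : realType.

Lemma derive_ge0_right (f : R -> R) (x df : R) :
  is_derive x 1 f df -> (forall y, x < y -> f x <= f y) -> 0 <= df.
Proof.
move=> [fdrvbl <-] fx; rewrite ['D_1 f x]cvg_at_rightE//.
apply: limr_ge.
  rewrite -(cvg_at_rightE (fun h : R => h^-1 *: ((f \o shift x) _ - f x))) //.
  apply: cvg_trans fdrvbl; apply: cvg_app => A [e egt0 Ae]; exists e => // y ye y0.
  by apply: Ae => //; exact: lt0r_neq0.
near=> h; have h0 : 0 < h by near: h; exists 1 => /=.
by rewrite mulr_ge0 ?invr_ge0 ?(ltW h0)// subr_ge0 fx//= [_%:A]mulr1 ltrDr.
Unshelve. all: by end_near. Qed.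

End DerivativeSign.

Section NodeDeterminant.
Variable R : realType.
Implicit Types (F : nat -> R -> R) (b : nat -> R) (s : seq (R * bool)).

(** Expansion along the last row: as a functional of that row the determinant is a
generalized polynomial with leading coefficient the determinant of one size less. *)
Lemma det_node_mx_rcons N F (rows : seq ((R -> R) -> R)) : size rows = N ->
  exists2 C : nat -> R, C N = \det (node_mx N F rows) &
    forall r, \det (node_mx N.+1 F (rcons rows r)) = \sum_(j < N.+1) C j * r (F j).
Proof.
move=> szr; pose M r := node_mx N.+1 F (rcons rows r).
exists (fun j => cofactor (M (fun=> 0)) ord_max (inord j)).
  have -> : inord N = ord_max :> 'I_N.+1 by apply/val_inj; rewrite /= inordK.
  rewrite /cofactor /= -signr_odd oddD addbb expr0 mul1r; congr (\det _).
  by apply/matrixP => i j; rewrite !mxE !lift_max nth_rcons szr ltn_ord.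
move=> r; rewrite (expand_det_row _ ord_max); apply: eq_bigr => j _.
rewrite mxE /= nth_rcons szr ltnn eqxx mulrC inord_val; congr (_ * _).
rewrite /cofactor; congr (_ * \det _); apply/matrixP => i k.
by rewrite !mxE lift_max !nth_rcons szr ltn_ord.
Qed.

Lemma det_node_mx_rep N F (rows : seq ((R -> R) -> R)) i j :
  (i < j < N)%N -> nth (fun=> 0) rows i = nth (fun=> 0) rows j ->
  \det (node_mx N F rows) = 0.
Proof.
move=> /andP[ij jN] rij.
have iN := ltn_trans ij jN.
apply: (@determinant_alternate _ _ _ (Ordinal iN) (Ordinal jN)).
  by rewrite -val_eqE /= ltn_eqF.
by move=> k; rewrite !mxE /= rij.
Qed.

Definition node_rows s : seq ((R -> R) -> R) :=
  flatten [seq if zb.2 then dbl zb.1 else pt zb.1 | zb <- s].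

Lemma size_node_rows s : size (node_rows s) = mult s.
Proof. by elim: s => // -[z b] s IH; rewrite /node_rows /= size_cat IH; case: b. Qed.

Lemma node_rows_cat s1 s2 : node_rows (s1 ++ s2) = node_rows s1 ++ node_rows s2.
Proof. by rewrite /node_rows map_cat flatten_cat. Qed.

Lemma mult_cat s1 s2 : mult (s1 ++ s2) = (mult s1 + mult s2)%N.
Proof. by rewrite /mult map_cat sumn_cat. Qed.

Lemma mem_node_rows s zb : zb \in s ->
  (exists2 i, (i < mult s)%N & nth (fun=> 0) (node_rows s) i = fun g => g zb.1) /\
  (zb.2 -> exists2 i, (i < mult s)%N &
     nth (fun=> 0) (node_rows s) i = fun g => derive1 g zb.1).
Proof.
move=> /path.splitP[s1 s2]; rewrite -cats1 -catA /= !node_rows_cat !mult_cat.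
have H i : nth (fun=> 0) (node_rows s1 ++ node_rows (zb :: s2)) (mult s1 + i)%N =
            nth (fun=> 0) (node_rows (zb :: s2)) i.
  by rewrite nth_cat size_node_rows ltnNge leq_addr /= addKn.
split.
  exists (mult s1 + 0)%N; first by rewrite ltn_add2l.
  by rewrite H /node_rows /=; case: zb.2.
move=> b; exists (mult s1 + 1)%N; first by rewrite ltn_add2l /mult /= b.
by rewrite H /node_rows /= b.
Qed.

Lemma derive1_powR (a z : R) : 0 < z -> derive1 (fun t => t `^ a) z = a * z `^ a / z.
Proof.
move=> z0; rewrite powR_derive1 ?in_itv ?andbT//=.
by rewrite powRB ?powRr1 ?(ltW z0) ?mulrA// (gt_eqF z0) implybT.
Qed.

Lemma gpoly_zeros_of_rows N b (c : nat -> R) s : {in s, forall zb : R * bool, 0 < zb.1} ->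
    (forall i, (i < mult s)%N ->
      \sum_(j < N) c j * nth (fun=> 0) (node_rows s) i (fun t => t `^ b j) = 0) ->
  {in s, forall zb : R * bool, gpoly N b c zb.1 = 0 /\
    (zb.2 -> gpoly N b (euler_coef b c) zb.1 = 0)}.
Proof.
move=> s0 H zb zbs; have [[i im iE] d] := mem_node_rows zbs; split.
  by rewrite -(H i im) iE.
move=> /d[k km kE]; have := H k km; rewrite kE => /eqP.
have z0 := s0 _ zbs.
under eq_bigr do rewrite (derive1_powR _ z0) !mulrA.
by rewrite -mulr_suml mulf_eq0 invr_eq0 (gt_eqF z0) orbF => /eqP.
Qed.

(** For large arguments the term of highest exponent dominates. *)
Lemma gpoly_gt0_near_infty N b c (y : R) :
  {homo b : i j / (i < j)%N >-> i < j} -> 0 < c N ->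
  exists2 z, y < z & 0 < gpoly N.+1 b c z.
Proof.
move=> b_lt cN; case: N cN => [|N] cN.
  exists (Num.max (y + 1) 1); first by rewrite lt_max ltrDl ltr01.
  by rewrite /gpoly big_ord1 mulr_gt0// powR_gt0// lt_max ltr01 orbT.
pose S := \sum_(j < N.+1) `|c j|.
have S0 : 0 <= S by exact: sumr_ge0.
(* [z ^ d > S / c N.+1] makes the last term exceed the sum of all the others. *)
pose d := b N.+1 - b N; have d0 : 0 < d by rewrite subr_gt0 b_lt.
pose T := S / c N.+1 + 1.
have T0 : 0 < T by rewrite ltr_wpDl// divr_ge0// ltW.
pose z := Num.max (Num.max (y + 1) 1) (T `^ d^-1).
have z1 : 1 <= z by rewrite !le_max lexx orbT.
have z0 : 0 < z by exact: lt_le_trans z1.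
exists z; first by rewrite !lt_max ltrDl ltr01.
have Tz : T <= z `^ d.
  have {1}-> : T = (T `^ d^-1) `^ d by rewrite -powRrM mulVf ?gt_eqF// powRr1// ltW.
  apply: ge0_ler_powR; rewrite ?nnegrE ?powR_ge0 ?(ltW d0) ?(ltW z0)//.
  by rewrite le_max lexx orbT.
rewrite /gpoly big_ord_recr /=.
have -> : b N.+1 = d + b N by rewrite /d subrK.
rewrite powRD; last by rewrite (gt_eqF z0) implybT.
have h : - (S * z `^ b N) <= \sum_(i < N.+1) c i * z `^ b i.
  rewrite lerNl -sumrN /S mulr_suml ler_sum// => j _.
  rewrite -mulNr (le_trans (ler_wpM2r (powR_ge0 _ _) (ler_norm _)))// normrN.
  rewrite ler_wpM2l// ler_powR//.
  have := ltn_ord j; rewrite ltnS leq_eqVlt => /predU1P[->//|/b_lt/ltW//].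
rewrite (lt_le_trans _ (lerD h (lexx _)))// mulrA -mulNr -mulrDl mulr_gt0 ?powR_gt0//.
rewrite addrC subr_gt0 -ltr_pdivrMl// mulrC (lt_le_trans _ Tz)// ltrDl//.
Qed.

(** All [N] zeros that [N.+1] terms can have are used up by [s], so there is no sign
change beyond the last node, where the sign is that of the leading coefficient. *)
Lemma gpoly_gt0_right N b c s (y : R) :
    {homo b : i j / (i < j)%N >-> i < j} -> 0 < c N ->
    sorted <%R (unzip1 (rcons s (y, false))) ->
    {in rcons s (y, false), forall zb : R * bool, 0 < zb.1} ->
    {in s, forall zb : R * bool, gpoly N.+1 b c zb.1 = 0 /\
      (zb.2 -> gpoly N.+1 b (euler_coef b c) zb.1 = 0)} ->
    mult s = N ->
  0 < gpoly N.+1 b c y.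
Proof.
move=> b_lt cN srt s0 sz ms; rewrite ltNge; apply/negP => gy.
have y0 : 0 < y by apply: (s0 (y, false)); rewrite mem_rcons mem_head.
have [z yz gz] := gpoly_gt0_near_infty y b_lt cN.
have [||w] := @IVT R (gpoly N.+1 b c) y z 0 (ltW yz).
- apply: derivable_within_continuous => x; rewrite in_itv /= => /andP[yx _].
  by have [] := gpoly_is_derive N.+1 b c (lt_le_trans y0 yx).
- by rewrite ge_min gy le_max (ltW gz) orbT.
rewrite in_itv /= => /andP[yw _] gw.
suff : c N = 0 by move=> c0; rewrite c0 ltxx in cN.
apply: (@gpoly_zeros R N.+1 b c (rcons s (w, false)) b_lt) => //.
- move: srt; rewrite /unzip1 !map_rcons /=; case: (map fst s) => //= a l.
  rewrite !rcons_path => /andP[-> /=] /lt_le_trans; exact.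
- move=> zb; rewrite mem_rcons inE => /predU1P[->|zbs] /=.
    exact: lt_le_trans yw.
  by apply: s0; rewrite mem_rcons inE zbs orbT.
- move=> zb; rewrite mem_rcons inE => /predU1P[->//|]; exact: sz.
- by rewrite -cats1 mult_cat ms addn1.
Qed.

(** Induction on the size, viewing the determinant as a functional of its last row.
The corresponding generalized polynomial vanishes at all earlier nodes and has
positive leading coefficient by induction, so it is positive to the right of them;
this settles a simple last node. For a double last node [z] the determinant is the
derivative at a zero followed by positive values, hence nonnegative, and it does not
vanish because [z] would otherwise be one zero too many. *)
Lemma node_det_gt0 N b s :
  {homo b : i j / (i < j)%N >-> i < j} -> sorted <%R (unzip1 s) ->
  {in s, forall zb : R * bool, 0 < zb.1} -> mult s = N ->
  0 < \det (node_mx N (fun i t => t `^ b i) (node_rows s)).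
Proof.
move=> b_lt; elim: N s => [|N IH] s srt s0 ms.
  by rewrite det_mx00 ltr01.
case/lastP: s srt s0 ms => // s [z d] srt s0 ms.
(* Nodes of the matrix without its last row. *)
pose s' := if d then rcons s (z, false) else s.
have ms' : mult s' = N.
  move: ms; rewrite /s' -cats1 mult_cat /mult /=; case: (d) => /= ms.
    by rewrite -cats1 map_cat sumn_cat /= addn1; lia.
  lia.
have unz : unzip1 (rcons s (z, d)) = unzip1 (rcons s (z, false)).
  by rewrite /unzip1 !map_rcons.
have srt' : sorted <%R (unzip1 s').
  rewrite /s'; case: ifP => _; first by rewrite -unz.
  move: srt; rewrite /unzip1 map_rcons; case: (map fst s) => //= a l.
  by rewrite rcons_path => /andP[].
have z0 : 0 < z by apply: (s0 (z, d)); rewrite mem_rcons mem_head.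
have s0' : {in rcons s (z, false), forall zb : R * bool, 0 < zb.1}.
  move=> zb; rewrite mem_rcons inE => /predU1P[->//|zbs].
  by apply: s0; rewrite mem_rcons inE zbs orbT.
have s'0 : {in s', forall zb : R * bool, 0 < zb.1}.
  rewrite /s'; case: ifP => _ // zb zbs.
  by apply: s0; rewrite mem_rcons inE zbs orbT.
pose r : (R -> R) -> R := if d then (fun g => derive1 g z) else (fun g => g z).
have rowsE : node_rows (rcons s (z, d)) = rcons (node_rows s') r.
  rewrite -!cats1 /s' /r node_rows_cat; case: (d) => //.
  by rewrite -[rcons s _]cats1 node_rows_cat -catA.
have szr : size (node_rows s') = N by rewrite size_node_rows.
have [C CN CE] := det_node_mx_rcons (fun i t => t `^ b i) szr.
have CN0 : 0 < C N by rewrite CN; exact: IH.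
have gs' : {in s', forall zb : R * bool, gpoly N.+1 b C zb.1 = 0 /\
      (zb.2 -> gpoly N.+1 b (euler_coef b C) zb.1 = 0)}.
  apply: gpoly_zeros_of_rows => // i; rewrite ms' => iN; rewrite -CE.
  apply: (@det_node_mx_rep _ _ _ i N); first by rewrite iN ltnSn.
  by rewrite !nth_rcons szr iN ltnn eqxx.
have gy y : z < y -> 0 < gpoly N.+1 b C y.
  move=> zy; apply: (@gpoly_gt0_right _ _ _ s') => //.
    move: srt; rewrite unz /s' /unzip1; case: ifP => _; rewrite !map_rcons.
      by case: (map fst s) => [|a l] /=; rewrite ?zy// !rcons_path /= last_rcons zy andbT.
    case: (map fst s) => [|a l] //=; rewrite !rcons_path /= => /andP[-> /=] /lt_trans; exact.
  move=> zb; rewrite mem_rcons inE => /predU1P[->|/s'0//]; exact: lt_trans zy.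
rewrite rowsE CE /r; case: ifP => dE; last first.
  apply: (@gpoly_gt0_right _ _ _ s') => //; rewrite /s' dE //.
  by rewrite -unz.
under eq_bigr do rewrite (derive1_powR _ z0) !mulrA.
rewrite -mulr_suml -/(gpoly N.+1 b (euler_coef b C) z).
have [gz _] : gpoly N.+1 b C z = 0 /\ (false -> gpoly N.+1 b (euler_coef b C) z = 0).
  by apply: (gs' (z, false)); rewrite /s' dE mem_rcons mem_head.
rewrite lt_neqAle; apply/andP; split; last first.
  apply: (derive_ge0_right (gpoly_is_derive N.+1 b C z0)) => y zy.
  by rewrite gz ltW// gy.
rewrite eq_sym mulf_neq0 ?invr_neq0 ?(gt_eqF z0)//.
apply/eqP => g'z; suff c0 : C N = 0 by rewrite c0 ltxx in CN0.
apply: (@gpoly_zeros R N.+1 b C (rcons s (z, d)) b_lt) => //; last by rewrite ms.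
move=> zb; rewrite mem_rcons inE => /predU1P[->//|zbs].
by apply: gs'; rewrite /s' dE mem_rcons inE zbs orbT.
Qed.

End NodeDeterminant.

(** * Determinants as functions of the point in their first row *)

Section RowMoves.
Variable R : realType.
Implicit Types (F : nat -> R -> R) (rows : seq ((R -> R) -> R)).

Lemma det_node_mx_swap N F pre a b post : ((size pre).+1 < N)%N ->
  \det (node_mx N F (pre ++ a :: b :: post)) =
  - \det (node_mx N F (pre ++ b :: a :: post)).
Proof.
move=> kN; have kN' := ltnW kN.
pose i := Ordinal kN'; pose j := Ordinal kN.
have ij : i != j by rewrite -val_eqE /= ltn_eqF.
suff -> : node_mx N F (pre ++ a :: b :: post) =
    perm_mx (tperm i j) *m node_mx N F (pre ++ b :: a :: post).
  by rewrite det_mulmx det_perm odd_tperm ij expr1 mulN1r.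
rewrite -row_permE; apply/matrixP => k l; rewrite !mxE.
case: tpermP => [->|->|ki kj] /=.
- by rewrite !nth_cat ltnn subnn ltnNge leqnSn subSnn.
- by rewrite !nth_cat ltnn subnn ltnNge leqnSn subSnn.
- rewrite !nth_cat; case: ltnP => // kp; case E : (k - size pre)%N => [|[|e]] //.
  + by case: ki; apply/val_inj => /=; lia.
  + by case: kj; apply/val_inj => /=; lia.
Qed.

(** Passing a double node exchanges the row [x] with two others, which leaves the sign
unchanged. *)
Lemma det_node_mx_move N F pre x (xs : seq R) post :
  (size pre + (2 * size xs).+1 <= N)%N ->
  \det (node_mx N F (pre ++ x :: flatten (map (@dbl R) xs) ++ post)) =
  \det (node_mx N F (pre ++ flatten (map (@dbl R) xs) ++ x :: post)).
Proof.
elim: xs pre => //= z xs IH pre sz.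
rewrite det_node_mx_swap; last by lia.
rewrite -cat_rcons det_node_mx_swap; last by rewrite size_rcons; lia.
rewrite opprK -cat_rcons IH; last by rewrite !size_rcons; lia.
by rewrite !cat_rcons.
Qed.

End RowMoves.

Section FirstRow.
Variable R : realType.

Lemma sorted_split (x : R) (xs : seq R) : sorted <%R xs ->
  exists l r, [/\ xs = l ++ r, {in l, forall y, y < x} & {in r, forall y, x <= y}].
Proof.
elim: xs => [|y xs IH] srt; first by exists [::], [::].
have [xy|yx] := leP x y.
  exists [::], (y :: xs); split=> // z; rewrite inE => /predU1P[->//|zxs].
  move: srt; rewrite /= (path_sortedE lt_trans) => /andP[/allP/(_ z zxs) yz _].
  exact: ltW (le_lt_trans xy yz).
have [l [r [-> ll rr]]] := IH (path_sorted srt).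
by exists (y :: l), r; split=> // z; rewrite inE => /predU1P[->//|/ll].
Qed.

Lemma node_rows_dbl (xs : seq R) :
  node_rows [seq (z, true) | z <- xs] = flatten (map (@dbl R) xs).
Proof. by rewrite /node_rows -map_comp. Qed.

Definition end_row (e : bool) : seq ((R -> R) -> R) := if e then pt 1 else [::].

(** The row of [x] can be moved to its place between the smaller and the larger nodes,
after which [node_det_gt0] applies. *)
Lemma point_row_det_gt0 N (b : nat -> R) (xs : seq R) (e : bool) (x : R) :
    {homo b : i j / (i < j)%N >-> i < j} -> path <%R 0 (rcons xs 1) ->
    N = ((2 * size xs).+1 + e)%N ->
    0 < x -> x <= 1 -> x \notin xs -> (e -> x < 1) ->
  0 < \det (node_mx N (fun i t => t `^ b i)
              (pt x ++ flatten (map (@dbl R) xs) ++ end_row e)).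
Proof.
move=> b_lt pxs NE x0 x1 xxs xe.
have pxs' : path <%R 0 xs by move: pxs; rewrite rcons_path => /andP[].
have xs0 : {in xs, forall y, 0 < y}.
  by move: pxs'; rewrite (path_sortedE lt_trans) => /andP[/allP].
have xs1 : {in xs, forall y, y < 1}.
  move: pxs => /path_sorted; rewrite (sorted_pairwise lt_trans) -cats1.
  rewrite pairwise_cat => /andP[/allrelP h _] y yxs; apply: h => //.
  by rewrite mem_head.
have [l [r [xsE ll rr]]] := sorted_split x (path_sorted pxs').
have rr' : {in r, forall y, x < y}.
  move=> y yr; rewrite lt_neqAle rr// andbT; apply: contraNneq xxs => ->.
  by rewrite xsE mem_cat yr orbT.
pose s := [seq (z, true) | z <- l] ++ (x, false) :: [seq (z, true) | z <- r] ++
          (if e then [:: (1, false)] else [::]).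
have unz : unzip1 s = l ++ x :: r ++ (if e then [:: 1] else [::]).
  rewrite /s /unzip1 map_cat /= map_cat -!map_comp !map_id.
  by case: (e).
have rowsE : node_rows s = flatten (map (@dbl R) l) ++
    (fun g : R -> R => g x) :: flatten (map (@dbl R) r) ++ end_row e.
  rewrite /s -[(x, false) :: _]cat1s !node_rows_cat !node_rows_dbl.
  by case: (e).
have -> : \det (node_mx N (fun i t => t `^ b i)
              (pt x ++ flatten (map (@dbl R) xs) ++ end_row e)) =
    \det (node_mx N (fun i t => t `^ b i) (node_rows s)).
  rewrite rowsE xsE map_cat flatten_cat -catA /=.
  rewrite -[LHS](congr1 (fun z => \det (node_mx N _ z)) (cat0s _)).
  by rewrite det_node_mx_move// NE xsE size_cat /=; lia.
apply: node_det_gt0 => //.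
- rewrite unz (sorted_pairwise lt_trans).
  move: (path_sorted pxs); rewrite (sorted_pairwise lt_trans) xsE -cats1 -catA.
  rewrite !pairwise_cat allrel_catr => /and3P[/andP[lr l1] pl /and3P[r1 pr _]].
  rewrite pl /= pairwise_cat pr allrel_consr allrel_catr lr all_cat.
  have -> : all (<%R x) r by apply/allP.
  have -> : all (fun y => y < x) l by apply/allP.
  by case: (e) xe => xe; rewrite ?allrel0r ?l1 ?r1 //= andbT xe.
- move=> zb; rewrite mem_cat inE mem_cat => /or4P[/mapP[y yl ->]|/eqP->//|/mapP[y yr ->]|].
  + by apply: xs0; rewrite xsE mem_cat yl.
  + by apply: xs0; rewrite xsE mem_cat yr orbT.
  + by case: (e) => //; rewrite inE => /eqP->.
- rewrite NE xsE /s !mult_cat size_cat.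
  have md (t : seq R) : mult [seq (z, true) | z <- t] = (2 * size t)%N.
    by rewrite /mult; elim: t => //= _ t ->; lia.
  rewrite md /mult /= -/(mult _) mult_cat md; case: (e) => /=; rewrite /mult /=; lia.
Qed.

(** The row of [x] is then repeated further down. *)
Lemma point_row_det_eq0 N (b : nat -> R) (xs : seq R) (e : bool) (x : R) :
    N = ((2 * size xs).+1 + e)%N -> (x \in xs) || e && (x == 1) ->
  \det (node_mx N (fun i t => t `^ b i)
              (pt x ++ flatten (map (@dbl R) xs) ++ end_row e)) = 0.
Proof.
move=> NE xx; pose s := [seq (z, true) | z <- xs] ++ if e then [:: (1, false)] else [::].
have rowsE : flatten (map (@dbl R) xs) ++ end_row e = node_rows s.
  by rewrite node_rows_cat node_rows_dbl; case: (e).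
have [d xs' ] : exists d, (x, d) \in s.
  case/orP: xx => [xxs|/andP[eT /eqP->]].
    by exists true; rewrite mem_cat map_f.
  by exists false; rewrite mem_cat eT mem_head orbT.
have [[i im iE] _] := mem_node_rows xs'.
apply: (@det_node_mx_rep _ _ _ _ 0 i.+1); last by rewrite rowsE /= iE.
rewrite NE; have : size (node_rows s) = (2 * size xs + e)%N.
  rewrite -rowsE size_cat; have -> : size (end_row e) = e by case: (e).
  by congr (_ + _)%N; elim: (xs) => //= _ t ->; lia.
by rewrite size_node_rows => ms; move: im; rewrite ms; lia.
Qed.

Lemma point_row_det_ge0 N (b : nat -> R) (xs : seq R) (e : bool) (x : R) :
    {homo b : i j / (i < j)%N >-> i < j} -> path <%R 0 (rcons xs 1) ->
    N = ((2 * size xs).+1 + e)%N -> 0 < x -> x <= 1 ->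
  0 <= \det (node_mx N (fun i t => t `^ b i)
              (pt x ++ flatten (map (@dbl R) xs) ++ end_row e)).
Proof.
move=> b_lt pxs NE x0 x1.
have [xx|] := boolP ((x \in xs) || e && (x == 1)).
  by rewrite point_row_det_eq0.
rewrite negb_or => /andP[xxs ex]; rewrite ltW// point_row_det_gt0// => eT.
by rewrite lt_neqAle x1 andbT; rewrite eT in ex.
Qed.

End FirstRow.

Section PowerSpan.
Variables (R : realType) (alpha : nat -> R).

Lemma mono_subproof i :
  ((fun t : R => t `^ alpha i) \_ `[0, 1])%FUN \in lin (power_system alpha).
Proof.
apply/asboolP; exists 1%N, (fun=> 1), (fun=> ((fun t : R => t `^ alpha i) \_ `[0, 1])%FUN).
by split=> [_|]; [exists i | rewrite big_ord1 scale1r].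
Qed.

Definition mono i : linType (power_system alpha) := LinType (mono_subproof i).

Definition span_elt N (c : nat -> R) : linType (power_system alpha) :=
  \sum_(j < N) c j *: mono j.

Lemma lin_fun_sum n (f : 'I_n -> linType (power_system alpha)) :
  (\sum_i f i : linType _) = \sum_i (f i : R -> R) :> (R -> R).
Proof. exact: (raddf_sum (val : linType (power_system alpha) -> R -> R)). Qed.

Lemma span_eltE N c x : x \in `[0, 1] -> span_elt N c x = gpoly N alpha c x.
Proof.
move=> x01; rewrite lin_fun_sum fct_sumE; apply: eq_bigr => j _ /=.
by rewrite -[LHS]/(c j * _ x) patchE mem_setE x01.
Qed.

(** All large [N] work for the same element, so the number of terms can be chosen of
a prescribed parity. *)
Lemma span_eltP (p : linType (power_system alpha)) :
  exists N0, forall N, (N0 <= N)%N -> exists c, p = span_elt N c.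
Proof.
case: p => f fP; have /asboolP[n [d [g [gP fE]]]] := fP.
have /choice[k kE] : forall i, exists k, g i = mono k.
  by move=> i; have [k _ <-] := gP i; exists k.
exists (\sum_i (k i).+1)%N => N kN.
have kltN i : (k i < N)%N.
  by apply: leq_trans kN; rewrite (bigD1 i)//= leq_addr.
exists (fun j => \sum_(i | k i == j) d i); apply/val_inj => /=.
rewrite fE lin_fun_sum.
rewrite [LHS](eq_bigr (fun i => \sum_(j < N | k i == j) d i *: (mono j : R -> R))); last first.
  move=> i _; rewrite (bigD1 (Ordinal (kltN i)))//= kE big1 ?addr0// => j.
  by case/andP=> /eqP kj /eqP []; apply/val_inj.
rewrite (exchange_big_dep xpredT)//=; apply: eq_bigr => j _.
by rewrite -scaler_suml.
Qed.

Hypothesis alpha_ge0 : forall i, 0 <= alpha i.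

Lemma powR_continuous01 (a : R) : 0 <= a -> {within `[0, 1], continuous (fun t : R => t `^ a)}.
Proof.
rewrite le_eqVlt => /predU1P[<-|a0].
  have -> : (fun t : R => t `^ 0) = fun=> 1 by apply/funext => t; rewrite powRr0.
  by apply: continuous_subspaceT => x; exact: cvg_cst.
apply/continuous_within_itvP; first exact: ltr01.
have ct (x : R) : 0 < x -> {for x, continuous (fun t : R => t `^ a)}.
  move=> x0; apply: differentiable_continuous; apply/derivable1_diffP.
  by have [] := is_derive1_powR a x0.
split.
- by move=> x; rewrite in_itv /= => /andP[x0 _]; exact: ct.
- by rewrite powR0 ?gt_eqF//; exact: powR_cvg0.
- by apply: cvg_at_left_filter; exact: ct.
Qed.

Lemma span_continuous (p : linType (power_system alpha)) : {within `[0, 1], continuous p}.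
Proof.
have [N /(_ N (leqnn N))[c ->]] := span_eltP p.
apply: (@subspace_eq_continuous _ _ _ (gpoly N alpha c)).
  move=> x; rewrite inE /= => x01; exact: (esym (span_eltE N c x01)).
elim: N => [|N IH] x.
  rewrite (_ : gpoly 0 alpha c = fun=> 0); first exact: cvg_cst.
  by apply/funext => t; rewrite /gpoly big_ord0.
rewrite (_ : gpoly N.+1 alpha c = fun t => gpoly N alpha c t + c N * t `^ alpha N).
  by apply: cvgD; [exact: IH | apply: cvgM; [exact: cvg_cst | exact: powR_continuous01]].
by apply/funext => t; rewrite /gpoly big_ord_recr.
Qed.

(** The sign of a determinant is known at positive points; continuity carries it to 0. *)
Lemma span_ge0_at0 (p : linType (power_system alpha)) :
  (forall x, 0 < x -> x <= 1 -> 0 <= p x) -> {in `[0, 1], forall x, 0 <= p x}.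
Proof.
move=> p0 x; rewrite in_itv /= => /andP[]; rewrite le_eqVlt => /predU1P[<- _|]; last exact: p0.
have [_ + _] := (continuous_within_itvP _ (@ltr01 R)).1 (@span_continuous p).
move/cvgr_to_ge; apply; near=> t; apply: p0; first by near: t; exact: nbhs_right_gt.
by near: t; apply: nbhs_right_le; exact: ltr01.
Unshelve. all: by end_near. Qed.

End PowerSpan.

(** * Zeros of nonnegative generalized polynomials *)

Section NodeLists.
Variable R : realType.
Implicit Types (xs zs : seq R).

Lemma path_rcons01 xs : path <%R 0 (rcons xs 1) =
  [&& all (fun x => 0 < x) xs, all (fun x => x < 1) xs & sorted <%R xs].
Proof.
rewrite -[path _ _ _]/(sorted <%R (0 :: rcons xs 1)) !(sorted_pairwise lt_trans) /=.
by rewrite all_rcons pairwise_rcons ltr01.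
Qed.

Lemma insert_node xs z : path <%R 0 (rcons xs 1) -> 0 < z -> z < 1 -> z \notin xs ->
  exists xs', [/\ path <%R 0 (rcons xs' 1), xs' =i z :: xs & size xs' = (size xs).+1].
Proof.
rewrite path_rcons01 => /and3P[/allP xs0 /allP xs1 srt] z0 z1 zxs.
have mem : sort <=%O (z :: xs) =i z :: xs by exact: mem_sort.
exists (sort <=%O (z :: xs)); split=> //; last by rewrite size_sort.
rewrite path_rcons01; apply/and3P; split.
- by apply/allP => y; rewrite mem inE => /predU1P[->//|/xs0].
- by apply/allP => y; rewrite mem inE => /predU1P[->//|/xs1].
- by rewrite sort_lt_sorted /= zxs lt_sorted_uniq.
Qed.

(** Padding at the right end keeps the given nodes in front, where a determinant of the
second kind, which drops the last node, still uses them. *)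
Lemma pad_nodes xs k : path <%R 0 (rcons xs 1) -> (size xs <= k)%N ->
  exists ys, [/\ path <%R 0 (rcons ys 1), size ys = k & take (size xs) ys = xs].
Proof.
move=> pxs; elim: k => [|k IH].
  by case: xs pxs => // pxs _; exists [::].
rewrite leq_eqVlt => /predU1P[szE|xk]; first by exists xs; rewrite take_size.
have [ys [pys szy tys]] := IH xk.
exists (rcons ys ((last 0 ys + 1) / 2)); split; last 2 first.
- by rewrite size_rcons szy.
- by rewrite -cats1 takel_cat// szy.
by move: pys; rewrite !rcons_path last_rcons -andbA => /andP[-> l1] /=; apply/andP; split; lra.
Qed.

End NodeLists.

Section Domination.
Variable R : realType.

(** Where [q x > e], the value [p x] stays away from 0 by compactness. The auxiliary
function [p + max (e - q) 0] has a positive minimum and equals [p] on that set. *)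
Lemma domination (p q : R -> R) (e : R) :
    {within `[0, 1], continuous p} -> {within `[0, 1], continuous q} ->
    {in `[0, 1], forall x, 0 <= p x} ->
    {in `[0, 1], forall x, p x = 0 -> q x = 0} -> 0 < e ->
  exists K, {in `[0, 1], forall x, q x <= e + K * p x}.
Proof.
move=> pc qc p0 pq e0.
pose h x := p x + Num.max (e - q x) 0.
have hc : {within `[0, 1], continuous h}.
  move=> x; apply: cvgD; first exact: pc.
  have h1 : {for x, continuous (fun x : subspace (`[0, 1]%classic : set R) => e - q x)}.
    by apply: cvgB; [exact: cvg_cst | exact: qc].
  have h2 : {for x, continuous (fun x : subspace (`[0, 1]%classic : set R) => 0 : R)}.
    exact: cvg_cst.
  exact: (continuous_max h1 h2).
have [a a01 amin] := EVT_min ler01 hc.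
have [b b01 bmax] := EVT_max ler01 qc.
have ha : 0 < h a.
  have [pa|pa] := eqVneq (p a) 0; first by rewrite /h pa pq// subr0 add0r lt_max e0.
  by rewrite /h ltr_pwDl ?le_max ?lexx ?orbT// lt_neqAle eq_sym pa p0.
exists (`|q b| / h a) => x x01.
have K0 : 0 <= `|q b| / h a by rewrite divr_ge0 ?normr_ge0// ltW.
have [qe|eq] := leP (q x) e.
  by rewrite (le_trans qe)// lerDl mulr_ge0// p0.
have hx : h x = p x by rewrite /h max_r ?addr0// subr_le0 ltW.
have hap : h a <= p x by rewrite -hx; exact: amin.
rewrite (le_trans (bmax _ x01))// (le_trans (ler_norm _))//.
rewrite -[leLHS](divfK (lt0r_neq0 ha)).
by rewrite (le_trans (ler_wpM2l K0 hap))// lerDr ltW.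
Qed.

End Domination.

Section Zeros.
Variables (R : realType) (alpha : nat -> R).
Hypothesis alpha0 : alpha 0%N = 0.
Hypothesis alpha_lt : {homo alpha : i j / (i < j)%N >-> i < j}.

Lemma gpoly_at0 N (c : nat -> R) : gpoly N.+1 alpha c 0 = c 0%N.
Proof.
rewrite gpoly_recl alpha0 powRr0 mulr1 /gpoly big1 ?addr0// => j _ /=.
by rewrite powR0 ?mulr0// gt_eqF// -alpha0 alpha_lt.
Qed.

Lemma ge0_zero_euler N (c : nat -> R) (z : R) :
    {in `[0, 1], forall x, 0 <= gpoly N alpha c x} -> 0 < z -> z < 1 ->
    gpoly N alpha c z = 0 -> gpoly N alpha (euler_coef alpha c) z = 0.
Proof.
move=> p0 z0 z1 pz.
have d (t : R) : t \in `]0, 1[ -> derivable (gpoly N alpha c) t 1.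
  by rewrite in_itv /= => /andP[t0 _]; have [] := gpoly_is_derive N alpha c t0.
have z01 : z \in `]0, 1[ by rewrite in_itv /= z0.
have [|_ D0] := derive1_at_min ler01 d z01.
  by move=> t t01; rewrite pz p0//; exact: subset_itv_oo_cc t01.
have [_ DE] := gpoly_is_derive N alpha c z0.
have /eqP : gpoly N alpha (euler_coef alpha c) z / z = 0 by rewrite -DE.
by rewrite mulf_eq0 invr_eq0 (gt_eqF z0) orbF => /eqP.
Qed.

(** Interior zeros of a nonnegative element are double. A zero at 0 kills the constant
term and thus lowers the number of terms by one, and a zero at 1 counts as a simple
node; [gpoly_zeros] gives the bound. *)
Lemma zero_count N (c : nat -> R) (zs : seq R) :
    {in `[0, 1], forall x, 0 <= gpoly N.+1 alpha c x} ->
    (exists2 j, (j < N.+1)%N & c j != 0) ->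
    path <%R 0 (rcons zs 1) -> {in zs, forall z, gpoly N.+1 alpha c z = 0} ->
  (2 * size zs + (gpoly N.+1 alpha c 0 == 0)%R + (gpoly N.+1 alpha c 1 == 0)%R <= N)%N.
Proof.
move=> p0 [j jN cj]; rewrite path_rcons01 => /and3P[/allP zs0 /allP zs1 srt] zsz.
pose e := gpoly N.+1 alpha c 1 == 0.
pose s := [seq (z, true) | z <- zs] ++ if e then [:: (1, false)] else [::].
have ms : mult s = (2 * size zs + e)%N.
  rewrite mult_cat; congr (_ + _)%N; last by case: (e).
  by rewrite /mult; elim: (zs) => //= _ t ->; lia.
have sz : {in s, forall zb : R * bool, gpoly N.+1 alpha c zb.1 = 0 /\
    (zb.2 -> gpoly N.+1 alpha (euler_coef alpha c) zb.1 = 0)}.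
  move=> zb; rewrite mem_cat => /orP[/mapP[z zzs ->]|] /=.
    by have z0 := zsz _ zzs; split=> // _; apply: ge0_zero_euler; rewrite ?zs0 ?zs1.
  by rewrite /e; case: eqP => // p1; rewrite inE => /eqP->.
have ssrt : sorted <%R (unzip1 s).
  have -> : unzip1 s = zs ++ if e then [:: 1] else [::].
    by rewrite /s /unzip1 map_cat -map_comp map_id; case: (e).
  rewrite (sorted_pairwise lt_trans) pairwise_cat -(sorted_pairwise lt_trans) srt.
  case: (e) => /=; rewrite ?allrel0r// andbT allrel1r.
  exact/allP.
have s0 : {in s, forall zb : R * bool, 0 < zb.1}.
  move=> zb; rewrite mem_cat => /orP[/mapP[z zzs ->]|] /=; first exact: zs0.
  by case: (e) => //; rewrite inE => /eqP->.
rewrite leqNgt; apply/negP => lt; move/negP: cj; apply; apply/eqP.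
move: lt; rewrite gpoly_at0 -/e; case: eqP => [c0|_] lt; last first.
  by apply: (gpoly_zeros alpha_lt ssrt s0 sz) => //; rewrite ms; lia.
have drop_c0 b x : gpoly N.+1 alpha (fun j => c j * b j) x =
    gpoly N (alpha \o succn) ((fun j => c j * b j) \o succn) x.
  by rewrite gpoly_recl c0 !mul0r add0r.
have drop_c x : gpoly N.+1 alpha c x = gpoly N (alpha \o succn) (c \o succn) x.
  by rewrite gpoly_recl c0 mul0r add0r.
case: j jN => // j jN.
apply: (@gpoly_zeros R N (alpha \o succn) (c \o succn) s) => //.
- by move=> i k ik; apply: alpha_lt.
- move=> zb zbs; rewrite -drop_c; split; first by have [] := sz _ zbs.
  by move=> b; have [_ /(_ b)] := sz _ zbs; rewrite drop_c0.
- by rewrite ms; lia.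
Qed.

(** By [zero_count] the lists of interior zeros have bounded length; a longest one
contains all interior zeros. *)
Lemma interior_zeros N (c : nat -> R) :
    {in `[0, 1], forall x, 0 <= gpoly N.+1 alpha c x} ->
    (exists2 j, (j < N.+1)%N & c j != 0) ->
  exists zs, [/\ path <%R 0 (rcons zs 1),
    forall z, 0 < z -> z < 1 -> gpoly N.+1 alpha c z = 0 -> z \in zs &
    (2 * size zs + (gpoly N.+1 alpha c 0 == 0)%R + (gpoly N.+1 alpha c 1 == 0)%R <= N)%N].
Proof.
move=> p0 cN.
pose P zs := path <%R 0 (rcons zs 1) /\ {in zs, forall z, gpoly N.+1 alpha c z = 0}.
pose Q k := `[< exists2 zs, P zs & size zs = k >].
have exQ : exists k, Q k.
  exists 0%N; apply/asboolP; exists [::] => //; split=> //=.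
  by rewrite ltr01.
have ubQ k : Q k -> (k <= N)%N.
  move=> /asboolP[zs [pzs zsz] <-]; have := zero_count p0 cN pzs zsz.
  rewrite -addnA => /(leq_trans (leq_addr _ _)) /(leq_trans _); apply.
  by rewrite leq_pmull.
case: (ex_maxnP exQ ubQ) => k /asboolP[zs [pzs zsz] szk] kmax.
exists zs; split=> //; last exact: zero_count.
move=> z z0 z1 pz; apply/negPn/negP => zzs.
have [zs' [pzs' mem sz']] := insert_node pzs z0 z1 zzs.
suff /kmax : Q k.+1 by rewrite ltnn.
apply/asboolP; exists zs'; last by rewrite sz' szk.
by split=> // y; rewrite mem inE => /predU1P[->//|]; exact: zsz.
Qed.

End Zeros.

(** * Minimizing a linear form over normalized nonnegative elements *)

Lemma sum_continuous (R : realType) (T : topologicalType) n (f : 'I_n -> T -> R) :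
  (forall i, continuous (f i)) -> continuous (fun x => \sum_i f i x).
Proof.
by move=> fc x; apply: cvg_big => //=; [exact: add_continuous | move=> i _; exact: fc].
Qed.

Section Minimizer.
Variables (R : realType) (alpha : nat -> R) (n : nat).
Hypothesis alpha_lt : {homo alpha : i j / (i < j)%N >-> i < j}.
Local Notation V := (linType (power_system alpha)).

Definition rv_elt (c : 'rV[R]_n.+1) : V := \sum_j c 0 j *: mono alpha j.

Lemma rv_eltE c : rv_elt c = span_elt alpha n.+1 (fun j => c 0 (inord j)).
Proof. by apply: eq_bigr => j _; rewrite inord_val. Qed.

Lemma span_elt_rv (c : nat -> R) : span_elt alpha n.+1 c = rv_elt (\row_j c j).
Proof. by apply: eq_bigr => j _; rewrite mxE. Qed.

(** Points of the open unit interval, as many as there are terms, so that an element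
of the span is determined by its values there. *)
Definition sample (i : nat) : R := i.+1%:R / n.+2%:R.

Lemma sample_gt0 i : 0 < sample i.
Proof. by rewrite divr_gt0 ?ltr0n. Qed.

Lemma sample_lt1 i : (i < n.+1)%N -> sample i < 1.
Proof. by move=> iN; rewrite ltr_pdivrMr ?ltr0n// mul1r ltr_nat. Qed.

Lemma sample_lt i j : (i < j)%N -> sample i < sample j.
Proof. by move=> ij; rewrite ltr_pM2r ?invr_gt0 ?ltr0n// ltr_nat. Qed.

Lemma sample01 i : (i < n.+1)%N -> sample i \in `[0, 1].
Proof. by move=> iN; rewrite in_itv /= !ltW ?sample_gt0 ?sample_lt1. Qed.

Definition sample_sum (p : V) : R := \sum_(i < n.+1) p (sample i).

Lemma sample_zeros (c : nat -> R) :
    (forall i, (i < n.+1)%N -> gpoly n.+1 alpha c (sample i) = 0) ->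
  forall j, (j < n.+1)%N -> c j = 0.
Proof.
move=> H; pose s := [seq (sample i, false) | i <- iota 0 n.+1].
have ms : mult s = n.+1.
  rewrite /mult /s -map_comp -[RHS](size_iota 0).
  by elim: (iota 0 n.+1) => //= ? l ->.
apply: (@gpoly_zeros R n.+1 alpha c s) => //; last by rewrite ms.
- rewrite /unzip1 -map_comp (_ : map _ _ = map sample (iota 0 n.+1)) //.
  by apply: (homo_sorted sample_lt); exact: iota_ltn_sorted.
- by move=> _ /mapP[i _ ->]; exact: sample_gt0.
- by move=> _ /mapP[i + ->]; rewrite mem_iota => /H.
Qed.

Definition feasible : set 'rV[R]_n.+1 :=
  [set c | {in `[0, 1], forall x, 0 <= rv_elt c x} /\ sample_sum (rv_elt c) = 1].

Lemma rv_elt_gpoly c x : x \in `[0, 1] ->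
  rv_elt c x = \sum_j c 0 j * x `^ alpha j.
Proof.
move=> x01; rewrite rv_eltE span_eltE//; apply: eq_bigr => j _.
by rewrite inord_val.
Qed.

Lemma linear_form_continuous (a : 'I_n.+1 -> R) :
  continuous (fun c : 'rV[R]_n.+1 => \sum_j c 0 j * a j).
Proof.
apply: (@sum_continuous R 'rV[R]_n.+1) => j x.
apply: (@continuousM R 'rV[R]_n.+1 (fun c => c 0 j) (fun=> a j)).
  exact: coord_continuous.
exact: (@cst_continuous 'rV[R]_n.+1 R (a j)).
Qed.

Lemma feasible_closed : closed feasible.
Proof.
have -> : feasible =
    (\bigcap_(x in `[0%R, 1%R]) [set c : 'rV[R]_n.+1 | 0 <= \sum_j c 0 j * x `^ alpha j]) `&`
    [set c : 'rV[R]_n.+1 | \sum_j c 0 j * (\sum_(i < n.+1) sample i `^ alpha j) = 1].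
  apply/seteqP; split=> c [h1 h2].
  - split=> [x x01 /=|]; first by rewrite -rv_elt_gpoly// h1.
    rewrite /= -h2 /sample_sum; under [RHS]eq_bigr do rewrite rv_elt_gpoly ?sample01//.
    by rewrite exchange_big; apply: eq_bigr => j _; rewrite mulr_sumr.
  - split=> [x x01 /=|]; first by rewrite rv_elt_gpoly//; exact: h1.
    rewrite /= -h2 /sample_sum; under eq_bigr do rewrite rv_elt_gpoly ?sample01//.
    by rewrite exchange_big; apply: eq_bigr => j _; rewrite mulr_sumr.
apply: closedI.
- apply: closed_bigI => x x01.
  apply: (@preimage_closed _ _ (fun c : 'rV[R]_n.+1 => \sum_j c 0 j * x `^ alpha j)
    [set y | 0 <= y]); last exact: closed_ge.
  by move=> c _; exact: linear_form_continuous.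
- apply: (@preimage_closed _ _
    (fun c : 'rV[R]_n.+1 => \sum_j c 0 j * (\sum_(i < n.+1) sample i `^ alpha j))
    [set y | y = 1]); last exact: closed_eq.
  by move=> c _; exact: linear_form_continuous.
Qed.

(** Coefficients are recovered from the sample values by an invertible matrix, and the
sample values of a feasible element lie between 0 and 1. *)
Lemma feasible_bounded : exists B, forall c, feasible c -> forall j, `|c 0 j| <= B.
Proof.
pose S : 'M[R]_n.+1 := \matrix_(j, i) sample i `^ alpha j.
have SE c i : (c *m S) 0 i = rv_elt c (sample i).
  by rewrite rv_elt_gpoly ?sample01// mxE; apply: eq_bigr => j _; rewrite mxE.
have Su : S \in unitmx.
  rewrite unitmxE unitfE; apply/negP => /det0P[v v0 vS].
  move/negP: v0; apply; apply/eqP/rowP => j; rewrite mxE.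
  rewrite -[j]inord_val.
  apply: (@sample_zeros (fun j => v 0 (inord j))) => // i iN.
  rewrite -span_eltE ?sample01// -rv_eltE.
  by have := SE v (Ordinal iN); rewrite vS mxE => <-.
exists (\sum_i \sum_j `|invmx S i j|) => c [c0 c1] j.
rewrite -[c](mulmxK Su) mxE (le_trans (ler_norm_sum _ _ _))// ler_sum// => i _.
rewrite normrM SE.
have p0 (k : 'I_n.+1) : 0 <= rv_elt c (sample k) by rewrite c0// sample01.
rewrite (ger0_norm (p0 i)).
have pi1 : rv_elt c (sample i) <= 1.
  by rewrite -c1 /sample_sum (bigD1 i)//= lerDl sumr_ge0.
rewrite (le_trans (ler_wpM2r (normr_ge0 _) pi1))// mul1r (bigD1 j)//= lerDl.
by rewrite sumr_ge0.
Qed.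

Lemma feasible_compact : compact feasible.
Proof.
have [B cB] := feasible_bounded.
apply: (@subclosed_compact _ _ [set v : 'rV[R]_n.+1 | forall i, v ord0 i \in `[- B, B]]).
- exact: feasible_closed.
- apply: (@rV_compact _ _ (fun=> `[- B, B]%classic)) => _; exact: segment_compact.
- by move=> c /cB cB' j; rewrite in_itv /= -ler_norml.
Qed.

Lemma feasible_minimizer (l : 'I_n.+1 -> R) : feasible !=set0 ->
  exists2 c, feasible c & forall d, feasible d ->
    \sum_j c 0 j * l j <= \sum_j d 0 j * l j.
Proof.
move=> fn0.
have [|c cf cmin] := compact_EVT_min fn0 feasible_compact
   (f := fun c : 'rV[R]_n.+1 => \sum_j c 0 j * l j).
  by apply: continuous_subspaceT; exact: linear_form_continuous.
exists c; first by rewrite inE in cf.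
by move=> d df; apply: cmin; rewrite inE.
Qed.

Lemma sample_sum_gt0 (c : nat -> R) :
    {in `[0, 1], forall x, 0 <= span_elt alpha n.+1 c x} ->
    (exists2 j, (j < n.+1)%N & c j != 0) ->
  0 < sample_sum (span_elt alpha n.+1 c).
Proof.
move=> c0 [j jN cj].
have s0 (i : 'I_n.+1) : true -> 0 <= span_elt alpha n.+1 c (sample i).
  by move=> _; rewrite c0// sample01.
rewrite lt_neqAle sumr_ge0// andbT eq_sym; apply/negP => /eqP t0.
move/negP: cj; apply; apply/eqP; apply: sample_zeros => // i iN.
rewrite -span_eltE ?sample01//.
exact: (psumr_eq0P s0 t0 (i := Ordinal iN)).
Qed.

End Minimizer.

(** * Positivity on the determinants implies positivity *)

Section Kinds.
Variable R : realType.

Lemma det_node_mx_cons n (F : nat -> R -> R) (rows : seq ((R -> R) -> R)) :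
  exists C : nat -> R, forall r,
    \det (node_mx n.+1 F (r :: rows)) = \sum_(j < n.+1) C j * r (F j).
Proof.
exists (fun j => cofactor (node_mx n.+1 F ((fun=> 0) :: rows)) ord0 (inord j)) => r.
rewrite (expand_det_row _ ord0); apply: eq_bigr => j _.
rewrite mxE mulrC inord_val; congr (_ * _).
by rewrite /cofactor; congr (_ * \det _); apply/matrixP => i k; rewrite !mxE.
Qed.

Variable alpha : nat -> R.
Hypotheses (alpha_ge0 : forall i, 0 <= alpha i) (alpha0 : alpha 0%N = 0).
Hypothesis alpha_lt : {homo alpha : i j / (i < j)%N >-> i < j}.
Local Notation V := (linType (power_system alpha)).

(** With [m] the number of pairs, these are the determinants of the first kind for [m]
and of the second kind for [m + 1]. *)
Definition lower_det (xs : seq R) (x : R) : R :=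
  \det (node_mx (2 * size xs).+1 (fun i t => t `^ alpha i)
    (pt x ++ flatten (map (@dbl R) xs))).

Definition upper_det (xs : seq R) (x : R) : R :=
  \det (node_mx (2 * size xs).+2 (fun i t => t `^ alpha i.+1)
    (pt x ++ flatten (map (@dbl R) xs) ++ pt 1)).

Let alpha_lt1 : {homo (alpha \o succn) : i j / (i < j)%N >-> i < j}.
Proof. by move=> i j ij; apply: alpha_lt. Qed.

Lemma lower_detE xs : exists c, forall x, lower_det xs x = gpoly (2 * size xs).+1 alpha c x.
Proof.
have [C CE] := det_node_mx_cons (2 * size xs) (fun i t => t `^ alpha i)
  (flatten (map (@dbl R) xs)).
by exists C => x; rewrite /lower_det /= CE.
Qed.

Lemma upper_detE xs : exists c, forall x,
  upper_det xs x = gpoly (2 * (size xs).+1).+1 alpha c x.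
Proof.
have [C CE] := det_node_mx_cons (2 * size xs).+1 (fun i t => t `^ alpha i.+1)
  (flatten (map (@dbl R) xs) ++ pt 1).
(* The constant term is absent, which makes room for one more double node. *)
exists (fun j => if j is j'.+1 then C j' else 0) => x.
by rewrite /upper_det /= CE mulnS gpoly_recl mul0r add0r.
Qed.

Lemma lower_det_ge0 xs x : path <%R 0 (rcons xs 1) -> 0 < x -> x <= 1 -> 0 <= lower_det xs x.
Proof.
move=> pxs x0 x1.
have := @point_row_det_ge0 R (2 * size xs).+1 alpha xs false x alpha_lt pxs _ x0 x1.
by rewrite cats0; apply; rewrite addn0.
Qed.

Lemma lower_det_gt0 xs x : path <%R 0 (rcons xs 1) -> 0 < x -> x <= 1 -> x \notin xs ->
  0 < lower_det xs x.
Proof.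
move=> pxs x0 x1 xxs.
have := @point_row_det_gt0 R (2 * size xs).+1 alpha xs false x alpha_lt pxs _ x0 x1 xxs.
by rewrite cats0; apply; rewrite ?addn0.
Qed.

Lemma lower_det_eq0 xs x : x \in xs -> lower_det xs x = 0.
Proof.
move=> xxs; have := @point_row_det_eq0 R (2 * size xs).+1 alpha xs false x.
by rewrite cats0 xxs; apply; rewrite ?addn0.
Qed.

Lemma upper_det_ge0 xs x : path <%R 0 (rcons xs 1) -> 0 < x -> x <= 1 -> 0 <= upper_det xs x.
Proof.
move=> pxs x0 x1.
by apply: (@point_row_det_ge0 R _ (alpha \o succn) xs true x) => //; rewrite addn1.
Qed.

Lemma upper_det_gt0 xs x : path <%R 0 (rcons xs 1) -> 0 < x -> x < 1 -> x \notin xs ->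
  0 < upper_det xs x.
Proof.
move=> pxs x0 x1 xxs.
apply: (@point_row_det_gt0 R _ (alpha \o succn) xs true x) => //; first by rewrite addn1.
exact: ltW.
Qed.

Lemma upper_det_eq0 xs x : (x \in xs) || (x == 0) || (x == 1) -> upper_det xs x = 0.
Proof.
case/orP => [/orP[xxs|/eqP->]|x1].
- by apply: (@point_row_det_eq0 R _ (alpha \o succn) xs true x); rewrite ?addn1// xxs.
- have [C CE] := det_node_mx_cons (2 * size xs).+1 (fun i t => t `^ alpha i.+1)
    (flatten (map (@dbl R) xs) ++ pt 1).
  rewrite /upper_det /= CE big1// => j _.
  by rewrite powR0 ?mulr0// gt_eqF// -alpha0 alpha_lt.
- by apply: (@point_row_det_eq0 R _ (alpha \o succn) xs true x); rewrite ?addn1// x1 orbT.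
Qed.

Lemma fresh_sample n (xs : seq R) : (size xs < n.+1)%N ->
  exists2 i, (i < n.+1)%N & sample R n i \notin xs.
Proof.
move=> sz; apply: contrapT => h.
have sub : {subset map (sample R n) (iota 0 n.+1) <= xs}.
  move=> _ /mapP[i + ->]; rewrite mem_iota => iN.
  by apply/negPn/negP => xi; apply: h; exists i.
have u : uniq (map (sample R n) (iota 0 n.+1)).
  apply: lt_sorted_uniq; apply: (homo_sorted (@sample_lt R n)); exact: iota_ltn_sorted.
by have := uniq_leq_size u sub; rewrite size_map size_iota leqNgt sz.
Qed.

Variable L : {scalar V}.

Lemma one_eltE x : x \in `[0, 1] -> mono alpha 0 x = 1.
Proof. by move=> x01; rewrite /= patchE mem_setE x01 alpha0 powRr0. Qed.

(** Let [r < 0] be the minimum of [L] over feasible elements and [q] a minimizer. Then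
[M = L - r * sample_sum] is nonnegative on nonnegative elements of the span and
[M q = 0]. A nonnegative [d] that vanishes at the zeros of [q] satisfies
[d <= e + K q] for all [e > 0], so [M d <= 0], and [L d < 0] follows. *)
Lemma psd_of_supporting (n : nat) (p : V) :
    (exists c, p = span_elt alpha n.+1 c) ->
    {in `[0, 1], forall x, 0 <= p x} ->
    (forall c, {in `[0, 1], forall x, 0 <= span_elt alpha n.+1 c x} ->
       (exists2 j, (j < n.+1)%N & c j != 0) ->
       exists d, [/\ 0 <= L (span_elt alpha n.+1 d),
         {in `[0, 1], forall x, 0 <= span_elt alpha n.+1 d x},
         0 < sample_sum n (span_elt alpha n.+1 d) &
         {in `[0, 1], forall x, span_elt alpha n.+1 c x = 0 -> span_elt alpha n.+1 d x = 0}]) ->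
  0 <= L p.
Proof.
move=> [c0 ->] p0 facet; rewrite leNgt; apply/negP => Lp.
pose l (j : 'I_n.+1) := L (mono alpha j).
have LE c : L (span_elt alpha n.+1 c) = \sum_(j < n.+1) c j * l j.
  by rewrite linear_sum; apply: eq_bigr => j _; rewrite linearZ.
have sample_sumD (a : R) (u v : V) :
    sample_sum n (a *: u + v) = a * sample_sum n u + sample_sum n v.
  by rewrite /sample_sum mulr_sumr -big_split.
have LD (a : R) (u v : V) : L (a *: u + v) = a * L u + L v by rewrite linearP.
have LZ (a : R) (u : V) : L (a *: u) = a * L u by rewrite linearZ.
have spanZ (a : R) c : span_elt alpha n.+1 (fun j => a * c j) = a *: span_elt alpha n.+1 c.
  by rewrite /span_elt scaler_sumr; apply: eq_bigr => j _; rewrite scalerA.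
have spanD c d : span_elt alpha n.+1 (fun j => c j + d j) =
    span_elt alpha n.+1 c + span_elt alpha n.+1 d.
  by rewrite /span_elt -big_split; apply: eq_bigr => j _; rewrite scalerDl.
have sample_sumZ (a : R) (u : V) : sample_sum n (a *: u) = a * sample_sum n u.
  by rewrite /sample_sum mulr_sumr.
have norm_feasible c : {in `[0, 1], forall x, 0 <= span_elt alpha n.+1 c x} ->
    0 < sample_sum n (span_elt alpha n.+1 c) ->
    feasible alpha (\row_(j < n.+1) ((sample_sum n (span_elt alpha n.+1 c))^-1 * c j)).
  move=> c_ge0 t0; rewrite /feasible /=.
  rewrite -(@span_elt_rv R alpha n
    (fun j => (sample_sum n (span_elt alpha n.+1 c))^-1 * c j)) spanZ.
  split.
    by move=> x x01; rewrite [leRHS]/= mulr_ge0 ?invr_ge0 ?(ltW t0) ?c_ge0.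
  by rewrite sample_sumZ mulVf ?gt_eqF.
have zero_elt c : (forall j, (j < n.+1)%N -> c j = 0) -> span_elt alpha n.+1 c = 0.
  by move=> c_eq0; rewrite /span_elt big1// => j _; rewrite c_eq0// scale0r.
have nonzero c : span_elt alpha n.+1 c != 0 -> exists2 j, (j < n.+1)%N & c j != 0.
  move=> nz; apply: contrapT => h; move/negP: nz; apply; apply/eqP/zero_elt => j jN.
  by apply/eqP/negPn/negP => cj; apply: h; exists j.
have p_neq0 : span_elt alpha n.+1 c0 != 0.
  by apply: contraTneq Lp => ->; rewrite linear0 ltxx.
have tp := sample_sum_gt0 alpha_lt p0 (nonzero _ p_neq0).
have [cm [cm0 cm1] cmin] := feasible_minimizer alpha_lt l (ex_intro _ _ (norm_feasible _ p0 tp)).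
pose r := \sum_j cm 0 j * l j.
have r_le c : {in `[0, 1], forall x, 0 <= span_elt alpha n.+1 c x} ->
    r * sample_sum n (span_elt alpha n.+1 c) <= L (span_elt alpha n.+1 c).
  move=> c_ge0; have [->|nz] := eqVneq (span_elt alpha n.+1 c) 0.
    by rewrite linear0 /sample_sum big1 ?mulr0.
  have t0 := sample_sum_gt0 alpha_lt c_ge0 (nonzero _ nz).
  have := cmin _ (norm_feasible _ c_ge0 t0).
  under [leRHS]eq_bigr do rewrite mxE -mulrA.
  by rewrite -mulr_sumr -LE ler_pdivlMl// mulrC.
have r_lt0 : r < 0.
  by have := le_lt_trans (r_le _ p0) Lp; rewrite pmulr_llt0.
pose c1 (j : nat) : R := cm 0 (inord j).
have c1E : span_elt alpha n.+1 c1 = rv_elt alpha cm by rewrite rv_eltE.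
have c1_ge0 : {in `[0, 1], forall x, 0 <= span_elt alpha n.+1 c1 x} by rewrite c1E.
have Lc1 : L (span_elt alpha n.+1 c1) = r.
  by rewrite LE; apply: eq_bigr => j _; rewrite /c1 inord_val.
have c1_neq0 : span_elt alpha n.+1 c1 != 0.
  rewrite c1E; apply: contra_eq_neq cm1 => ->.
  by rewrite /sample_sum big1// eq_sym oner_neq0.
have [d [Ld d0 td zd]] := facet _ c1_ge0 (nonzero _ c1_neq0).
pose u j : R := (j == 0%N)%:R.
have uE : span_elt alpha n.+1 u = mono alpha 0.
  rewrite /span_elt (bigD1 ord0)//= scale1r big1 ?addr0// => j.
  by rewrite -val_eqE /u /= => /negPf->; rewrite scale0r.
pose M c := L (span_elt alpha n.+1 c) - r * sample_sum n (span_elt alpha n.+1 c).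
have M_ge0 c : {in `[0, 1], forall x, 0 <= span_elt alpha n.+1 c x} -> 0 <= M c.
  by move=> c_ge0; rewrite subr_ge0 r_le.
have u0 : {in `[0, 1], forall x, 0 <= span_elt alpha n.+1 u x}.
  by move=> x x01; rewrite uE one_eltE.
have Md : M d <= 0.
  apply/ler_addgt0Pr => e e0; rewrite add0r.
  pose e' := e / (M u + 1).
  have Mu1 : 0 < M u + 1 by rewrite ltr_wpDl// M_ge0.
  have e'0 : 0 < e' by rewrite divr_gt0.
  have [K KP] := domination (@span_continuous R alpha alpha_ge0 (span_elt alpha n.+1 c1))
    (@span_continuous R alpha alpha_ge0 (span_elt alpha n.+1 d)) c1_ge0 zd e'0.
  pose w j := e' * u j + (K * c1 j + (-1) * d j).
  have wE : span_elt alpha n.+1 w = e' *: span_elt alpha n.+1 u +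
      (K *: span_elt alpha n.+1 c1 + (-1) *: span_elt alpha n.+1 d).
    rewrite /w (spanD (fun j => e' * u j)) (spanD (fun j => K * c1 j)).
    by rewrite !spanZ.
  have w0 : {in `[0, 1], forall x, 0 <= span_elt alpha n.+1 w x}.
    move=> x x01; rewrite wE uE.
    have -> : (e' *: mono alpha 0 + (K *: span_elt alpha n.+1 c1 +
       (-1) *: span_elt alpha n.+1 d) : V) x =
       e' * mono alpha 0 x + (K * span_elt alpha n.+1 c1 x - span_elt alpha n.+1 d x).
      by rewrite -(mulN1r (span_elt alpha n.+1 d x)).
    by rewrite one_eltE// mulr1 addrA subr_ge0 KP.
  have := M_ge0 _ w0; rewrite /M wE !sample_sumD !sample_sumZ !LD LZ.
  have -> : sample_sum n (span_elt alpha n.+1 c1) = 1 by rewrite c1E.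
  rewrite Lc1 => h.
  have hh : M d <= e' * M u by rewrite /M; move: h; lra.
  by rewrite (le_trans hh)// /e' mulrAC ler_pdivrMr// ler_pM2l// lerDl ler01.
have : r * sample_sum n (span_elt alpha n.+1 d) < 0 by rewrite nmulr_rlt0.
by move: Md; rewrite /M; lra.
Qed.

Hypothesis L1 : forall (xs : seq R) (p : V), (0 < size xs)%N -> path <%R 0 (rcons xs 1) ->
  {in `[0, 1], forall x, p x = lower_det xs x} -> 0 <= L p.
Hypothesis L2 : forall (xs : seq R) (y : R) (p : V), path <%R 0 (rcons (rcons xs y) 1) ->
  {in `[0, 1], forall x, p x = upper_det xs x} -> 0 <= L p.

(** The span of [2m + 1] powers is taken. If the minimizer [c] vanishes at neither end
point, it has at most [m] interior zeros, and a determinant of the first kind vanishes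
at all of them. Otherwise it has at most [m - 1] interior zeros, and a determinant of
the second kind vanishes at these and at both end points. *)
Lemma psd_of_determinants (p : V) : {in `[0, 1], forall x, 0 <= p x} -> 0 <= L p.
Proof.
move=> p0; have [N0 N0P] := span_eltP p.
pose m := N0.+1.
have sp : exists c, p = span_elt alpha (2 * m).+1 c by apply: N0P; rewrite /m; lia.
apply: (psd_of_supporting sp p0) => c c0 cn0.
have c0' : {in `[0, 1], forall x, 0 <= gpoly (2 * m).+1 alpha c x}.
  by move=> x x01; rewrite -span_eltE// c0.
have [zs [pzs zsP zsz]] := interior_zeros alpha0 alpha_lt c0' cn0.
have zs_in x : x \in `[0, 1] -> gpoly (2 * m).+1 alpha c x = 0 ->
    [\/ x = 0, x = 1 | x \in zs].
  rewrite in_itv /= => /andP[]; rewrite le_eqVlt => /predU1P[<- _ _|x0].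
    by constructor 1.
  rewrite le_eqVlt => /predU1P[-> _|x1 px]; first by constructor 2.
  by constructor 3; exact: zsP.
have szm : (size zs <= m)%N.
  by move: zsz; rewrite -addnA => /(leq_trans (leq_addr _ _)); rewrite leq_pmul2l.
have [ys [pys szy tys]] := pad_nodes pzs szm.
have mk (k : R -> R) d : (forall x, k x = gpoly (2 * m).+1 alpha d x) ->
    (forall x, 0 < x -> x <= 1 -> 0 <= k x) ->
    (exists2 i, (i < (2 * m).+1)%N & 0 < k (sample R (2 * m) i)) ->
    [/\ {in `[0, 1], forall x, span_elt alpha (2 * m).+1 d x = k x},
      {in `[0, 1], forall x, 0 <= span_elt alpha (2 * m).+1 d x} &
      0 < sample_sum (2 * m) (span_elt alpha (2 * m).+1 d)].
  move=> kE k0 [i iN ki].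
  have dE : {in `[0, 1], forall x, span_elt alpha (2 * m).+1 d x = k x}.
    by move=> x x01; rewrite span_eltE// kE.
  have d0 : {in `[0, 1], forall x, 0 <= span_elt alpha (2 * m).+1 d x}.
    apply: span_ge0_at0 => // x x0 x1; rewrite dE ?k0// in_itv /= x1 andbT.
    exact: ltW.
  split=> //; rewrite /sample_sum (bigD1 (Ordinal iN))//= ltr_pwDl//.
    by rewrite dE// sample01.
  by rewrite sumr_ge0// => j _; rewrite d0// sample01.
have [i iN iys] : exists2 i, (i < (2 * m).+1)%N & sample R (2 * m) i \notin ys.
  by apply: fresh_sample; rewrite szy /m; lia.
have [z0|nz] := boolP ((gpoly (2 * m).+1 alpha c 0 == 0) || (gpoly (2 * m).+1 alpha c 1 == 0)).
- have szm' : (size zs <= m.-1)%N.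
    have : (2 * size zs + 1 <= 2 * m)%N.
      apply: leq_trans zsz; rewrite -addnA leq_add2l.
      by case/orP: z0 => ->; rewrite ?addn1.
    by rewrite /m; lia.
  case/lastP: ys szy pys tys iys => [//|ys y]; rewrite size_rcons => -[szy] pys tys iys.
  have pys' : path <%R 0 (rcons ys 1).
    move: pys; rewrite !path_rcons01 !all_rcons => /and3P[/andP[_ ->] /andP[_ ->]].
    by rewrite !(sorted_pairwise lt_trans) pairwise_rcons => /andP[].
  have [d dE] := upper_detE ys; rewrite szy in dE.
  have [||dk d0 td] := mk (upper_det ys) d dE.
  + by move=> x x0 x1; exact: upper_det_ge0.
  + exists i => //; apply: upper_det_gt0 => //; rewrite ?sample_gt0 ?sample_lt1//.
    by move: iys; rewrite mem_rcons inE negb_or => /andP[].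
  exists d; split=> //; first exact: (L2 pys dk).
  move=> x x01; rewrite span_eltE// dk// => /(zs_in _ x01) h; apply: upper_det_eq0.
  case: h => [->|->|xzs]; rewrite ?eqxx ?orbT//.
  have : x \in take (size zs) (rcons ys y) by rewrite tys.
  by rewrite -cats1 takel_cat ?szy// => /mem_take ->.
- have [d dE] := lower_detE ys; rewrite szy in dE.
  have [||dk d0 td] := mk (lower_det ys) d dE.
  + by move=> x x0 x1; exact: lower_det_ge0.
  + by exists i => //; apply: lower_det_gt0 => //; rewrite ?sample_gt0// ltW// sample_lt1.
  exists d; split=> //; first by apply: (L1 _ pys dk); rewrite szy.
  move=> x x01; rewrite span_eltE// dk// => px; apply: lower_det_eq0.
  have [x0|x1|xzs] := zs_in _ x01 px.
  + by rewrite x0 in px; rewrite px eqxx in nz.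
  + by rewrite x1 in px; rewrite px eqxx orbT in nz.
  + by apply: (@mem_take (size zs)); rewrite tys.
Qed.

End Kinds.

(** * Extension of positive functionals and quantile measures *)

Section PositiveExtension.
Variables (R : realType) (X : Type) (D : set X).
Implicit Types (G : set ((X -> R) * R)) (f g : X -> R).

(** Partial functionals are represented by their graphs, which Zorn's lemma orders by
inclusion. Positivity implies single-valuedness on [D]. *)
Definition positive_graph G :=
  [/\ G (0, 0),
    (forall a f u g v, G (f, u) -> G (g, v) -> G (a \*: f + g, a * u + v)) &
    (forall f u, G (f, u) -> (forall x, D x -> 0 <= f x) -> 0 <= u)].

Lemma positive_graph_le G f u g v : positive_graph G -> G (f, u) -> G (g, v) ->
  (forall x, D x -> f x <= g x) -> u <= v.
Proof.
move=> [_ Glin Gpos] Gf Gg fg.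
have := Gpos _ _ (Glin (-1) _ _ _ _ Gf Gg); rewrite mulN1r (addrC (- u)) subr_ge0; apply.
by move=> x Dx; rewrite -[leRHS]/(-1 * f x + g x) mulN1r addrC subr_ge0 fg.
Qed.

Lemma positive_graph_Z G a f u : positive_graph G -> G (f, u) -> G (a \*: f, a * u).
Proof.
move=> [G0 Glin _] Gf; have := Glin a _ _ _ _ Gf G0.
by rewrite !addr0.
Qed.

Lemma positive_graph_D G f u g v : positive_graph G -> G (f, u) -> G (g, v) ->
  G (f + g, u + v).
Proof.
move=> [_ Glin _] Gf Gg; have := Glin 1 _ _ _ _ Gf Gg.
by rewrite mul1r (_ : 1 \*: f = f)//; apply/funext => x; exact: mul1r.
Qed.

Lemma positive_graph_sum G n (f : 'I_n -> X -> R) (u : 'I_n -> R) : positive_graph G ->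
  (forall i, G (f i, u i)) -> G (\sum_i f i, \sum_i u i).
Proof.
move=> pG Gf; apply: (big_rec2 (fun f u => G (f, u))); first by have [] := pG.
by move=> i v h _ Gh; exact: positive_graph_D.
Qed.

(** M. Riesz' extension: if [f] is bounded by a multiple of [e] and has no value in a
maximal graph, the values at minorants of [f] lie below those at majorants, so
[f] can be given the supremum of the former without losing positivity. *)
Lemma positive_extension G0 e c : positive_graph G0 -> G0 (e, c) ->
    (forall x, D x -> 1 <= e x) ->
  exists G, [/\ positive_graph G, G0 `<=` G &
    forall f B, (forall x, D x -> `|f x| <= B) -> exists u, G (f, u)].
Proof.
move=> pG0 G0e e1.
(* The union of the empty chain is [set0], which must satisfy [P]. *)
pose P G := G = set0 \/ (positive_graph G /\ G0 `<=` G).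
have [F FP Ftot|G [PG Gmax]] := @Zorn_bigcup _ P.
  have [[G1 FG1 G1n]|Fe] := pselect (exists2 G, F G & G <> set0); last first.
    left; apply/seteqP; split=> // x [G FG Gx].
    by apply: Fe; exists G => // G0E; rewrite G0E in Gx.
  have pF G x : F G -> G x -> positive_graph G /\ G0 `<=` G.
    by move=> FG Gx; have [GE|//] := FP G FG; rewrite GE in Gx.
  have [G1E|[pG1 G01]] := FP G1 FG1; first by case: G1n.
  right; split; last by move=> x G0x; exists G1 => //; exact: G01.
  split.
  - by exists G1 => //; apply: G01; have [] := pG0.
  - move=> a f u g v [Gf FGf Gfu] [Gg FGg Ggv].
    have [[_ flin _] _] := pF _ _ FGf Gfu; have [[_ glin _] _] := pF _ _ FGg Ggv.
    have [fg|gf] := Ftot _ _ FGf FGg.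
    + by exists Gg => //; apply: glin => //; exact: fg.
    + by exists Gf => //; apply: flin => //; exact: gf.
  - move=> f u [Gf FGf Gfu] f0; have [[_ _ fpos] _] := pF _ _ FGf Gfu.
    exact: fpos Gfu f0.
have [GE|[pG G0G]] := PG.
  exfalso; apply: (Gmax G0); last by right; split.
  rewrite GE; split=> // /(_ (e, c)); exact.
exists G; split=> // f B fB; apply: contrapT => nf.
have Ge : G (e, c) := G0G _ G0e.
have [G00 Glin Gpos] := pG.
pose S := [set u | exists2 h, G (h, u) & forall x, D x -> h x <= f x].
have eB x : D x -> `|f x| <= `|B| * e x.
  move=> Dx; rewrite (le_trans (fB _ Dx))// (le_trans (ler_norm _))//.
  by rewrite ler_peMr ?e1.
have S0 : S !=set0.
  exists (- `|B| * c); exists (- `|B| \*: e); first exact: positive_graph_Z.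
  move=> x Dx; rewrite -[leLHS]/(- `|B| * e x) mulNr lerNl.
  by rewrite (le_trans _ (eB _ Dx))// -normrN ler_norm.
have ubS g v : G (g, v) -> (forall x, D x -> f x <= g x) -> ubound S v.
  move=> Gg fg u [h Gh hf]; apply: (positive_graph_le pG Gh Gg) => x Dx.
  exact: le_trans (hf _ Dx) (fg _ Dx).
have hubS : has_ubound S.
  exists (`|B| * c); apply: ubS; first exact: (positive_graph_Z `|B| pG Ge).
  by move=> x Dx; rewrite (le_trans (ler_norm _))//; exact: eB.
pose a := sup S.
have leSa h u : G (h, u) -> (forall x, D x -> h x <= f x) -> u <= a.
  by move=> Gh hf; apply: ub_le_sup => //; exists h.
have leaU g v : G (g, v) -> (forall x, D x -> f x <= g x) -> a <= v.
  by move=> Gg fg; apply: ge_sup => //; exact: ubS fg.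
pose G' := [set hu : (X -> R) * R | exists h u t,
  G (h, u) /\ hu = (h + t \*: f, u + t * a)].
have GG' : G `<=` G'.
  move=> [h u] Gh; exists h, u, 0; split=> //; congr (_, _); last by rewrite mul0r addr0.
  by apply/funext => x; rewrite -[RHS]/(h x + 0 * f x) mul0r addr0.
have G'f : G' (f, a).
  exists 0, 0, 1; split=> //; congr (_, _); last by rewrite mul1r add0r.
  by apply/funext => x; rewrite -[RHS]/(0 + 1 * f x) mul1r add0r.
apply: (Gmax G').
  split; last by move=> /(_ _ G'f) Gf; apply: nf; exists a.
  exact: GG'.
right; split; last by apply: subset_trans GG'.
split; first exact: GG'.
- move=> b _ _ _ _ [h [u [t [Gh [-> ->]]]]] [k [v [s [Gk [-> ->]]]]].
  exists (b \*: h + k), (b * u + v), (b * t + s); split; first exact: Glin.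
  congr (_, _); last by ring.
  apply/funext => x; rewrite -[LHS]/(b * (h x + t * f x) + (k x + s * f x)).
  by rewrite -[RHS]/(b * h x + k x + (b * t + s) * f x); ring.
- move=> _ _ [h [u [t [Gh [-> ->]]]]] hpos.
  have {}hpos x : D x -> 0 <= h x + t * f x by exact: hpos.
  have [t0|t0|t0] := ltgtP t 0.
  + have h1 : a <= (- t)^-1 * u.
      apply: (leaU _ _ (positive_graph_Z (- t)^-1 pG Gh)) => x Dx.
      rewrite -[leRHS]/((- t)^-1 * h x) ler_pdivlMl ?oppr_gt0//.
      by have := hpos x Dx; lra.
    by move: h1; rewrite ler_pdivlMl ?oppr_gt0//; lra.
  + have h1 : (- t^-1) * u <= a.
      apply: (leSa _ _ (positive_graph_Z (- t^-1) pG Gh)) => x Dx.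
      rewrite -[leLHS]/(- t^-1 * h x) mulNr lerNl ler_pdivlMl//.
      by have := hpos x Dx; lra.
    by move: h1; rewrite mulNr lerNl ler_pdivlMl//; lra.
  + rewrite t0 mul0r addr0; apply: (Gpos _ _ Gh) => x Dx.
    by have := hpos x Dx; rewrite t0 mul0r addr0.
Qed.

End PositiveExtension.

Section Quantile.
Variable R : realType.

Lemma count_lt (N : nat) (z : R) : 0 <= z -> z <= N%:R ->
  z <= \sum_(j < N) (j%:R < z)%R%:R.
Proof.
move=> z0; elim: N => [|N IH] zN; first by rewrite big_ord0.
rewrite big_ord_recr /=; have [zle|zlt] := leP z N%:R.
  by rewrite (le_trans (IH zle))// lerDl ler0n.
have -> : \sum_(i < N) (i%:R < z)%R%:R = N%:R :> R.
  rewrite (eq_bigr (fun=> 1)) ?sumr_const ?card_ord// => i _.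
  by rewrite (lt_trans _ zlt)// ltr_nat.
by rewrite (le_trans zN)// -natr1.
Qed.

Lemma count_le (N : nat) (z : R) : 0 <= z ->
  \sum_(j < N) (j%:R <= z)%R%:R <= z + 1.
Proof.
move=> z0; elim: N => [|N IH]; first by rewrite big_ord0 addr_ge0.
rewrite big_ord_recr /=; have [Nz|_] := leP N%:R z; last by rewrite addr0.
rewrite lerD2r (le_trans _ Nz)// -[N in leRHS]card_ord -sumr_const.
by apply: ler_sum => i _; rewrite lern1 leq_b1.
Qed.

(** [T] prescribes the masses of the tails [x > a]. The push-forward of Lebesgue measure
on [[0, c]] under the quantile function [q u = sup {a | u <= T a}] has the required
tails because, for [a] in the unit interval, [q u > a] implies [u <= T a], which in
turn implies [q u >= a]. *)
Lemma quantile_measure (T : R -> R) (c : R) :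
    (forall a b, a <= b -> T b <= T a) -> (forall a, 0 <= T a <= c) ->
  exists mu : {measure set (measurableTypeR R) -> \bar R},
    [/\ mu `[0%R, 1%R]%classic = c%:E,
      forall a, 0 <= a -> (mu (`]a, +oo[%classic `&` `[0%R, 1%R]%classic) <= (T a)%:E)%E &
      forall a, 0 <= a -> a <= 1 ->
        ((T a)%:E <= mu (`[a, +oo[%classic `&` `[0%R, 1%R]%classic))%E].
Proof.
move=> Tni T0c.
(* The alternative [a = 0] keeps the set nonempty when [u > T 0]: the mass that the
   tails miss is put at 0. *)
pose Q u := [set a | a = 0 \/ [/\ 0 <= a, a <= 1 & u <= T a]].
pose q u := sup (Q u).
have Qn0 u : Q u !=set0 by exists 0; left.
have Qub u : ubound (Q u) 1 by move=> a [->|[_ a1 _]].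
have Qhub u : has_ubound (Q u) by exists 1.
have q0 u : 0 <= q u by apply: ub_le_sup => //; left.
have q1 u : q u <= 1 by apply: ge_sup.
have c0 : 0 <= c by have /andP[] := T0c 0; exact: le_trans.
have qni : nonincreasing_fun q.
  move=> u v uv; apply: ge_sup => // a [->//|[a0 a1 va]].
  by apply: ub_le_sup => //; right; split=> //; exact: le_trans va.
have mq : measurable_fun [set: measurableTypeR R] (q : measurableTypeR R -> measurableTypeR R).
  by apply: measurable_realfun.nonincreasing_measurable.
pose leb := mrestr (@lebesgue_measure R) (measurable_itv `[0, c]).
exists (measure_function_pushforward__canonical__measure_function_Measure leb mq).
have mpre (a : itv_bound R) : measurable
    (q @^-1` ([set` Interval a +oo%O] `&` `[0, 1]) `&` `[0, c] : set (measurableTypeR R)).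
  apply: measurableI; last exact: measurable_itv.
  rewrite -[X in measurable X]setTI; apply: mq => //.
  by apply: measurableI; exact: measurable_itv.
have itv0 (b : R) : 0 <= b -> lebesgue_measure (`[0, b]%classic : set R) = b%:E.
  move=> b0; rewrite lebesgue_measure_itv /= lte_fin.
  case: ltgtP b0 => // [b0 _|<- _]; first by rewrite sube0.
  by [].
split.
- rewrite /= /pushforward /leb /mrestr (_ : _ `&` _ = `[0, c]%classic) ?itv0//.
  apply/seteqP; split=> [x []//|x xc]; split=> //=.
  by rewrite in_itv /= q0 q1.
- move=> a a0; have /andP[Ta0 _] := T0c a.
  rewrite /= /pushforward /leb /mrestr -(itv0 _ Ta0); apply: le_measure.
  + by rewrite inE; exact: mpre.
  + by rewrite inE; exact: measurable_itv.
  + move=> u [[/=]]; rewrite !in_itv /= andbT => aq _ /andP[u0 _].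
    rewrite u0 /=; have [b [bE|[b0 b1 ub]] ab] := sup_gt (Qn0 u) aq.
      by move: ab; rewrite bE ltNge a0.
    by rewrite (le_trans ub)// Tni// ltW.
- move=> a a0 a1; have /andP[Ta0 Tac] := T0c a.
  rewrite /= /pushforward /leb /mrestr -(itv0 _ Ta0); apply: le_measure.
  + by rewrite inE; exact: measurable_itv.
  + by rewrite inE; exact: mpre.
  + move=> u /=; rewrite in_itv /= => /andP[u0 uT].
    split; last by rewrite /= in_itv /= u0 (le_trans uT).
    split; rewrite /= in_itv /= ?andbT ?q0 ?q1//.
    by apply: ub_le_sup => //; right.
Qed.

End Quantile.

(** * Representation by a measure *)

Section Moment.
Variable R : realType.
Local Notation I01 := (`[0%R, 1%R]%classic : set (measurableTypeR R)).

Lemma integral_steps (mu : {measure set (measurableTypeR R) -> \bar R}) N (w : R)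
    (B : 'I_N -> set (measurableTypeR R)) : 0 <= w -> (forall j, measurable (B j)) ->
  (\int[mu]_(x in I01) (\sum_(j < N) w * \1_(B j) x)%:E =
   \sum_(j < N) w%:E * mu (B j `&` I01))%E.
Proof.
move=> w0 mB; have mI : measurable I01 by exact: measurable_itv.
under eq_integral do rewrite -sumEFin.
rewrite ge0_integral_sum//.
- apply: eq_bigr => j _; under eq_integral do rewrite EFinM.
  rewrite ge0_integralZl_EFin// ?integral_indic//.
  by apply/measurable_EFinP; exact: measurable_indic.
- by move=> j; apply/measurable_EFinP/measurable_funM => //; exact: measurable_indic.
- by move=> j x _; rewrite lee_fin mulr_ge0.
Qed.

Lemma powR_lt_root (b a x : R) : 0 < b -> 0 <= a -> 0 <= x ->
  ((a `^ b^-1 < x) = (a < x `^ b)) * ((a `^ b^-1 <= x) = (a <= x `^ b)).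
Proof.
move=> b0 a0 x0; have aE : (a `^ b^-1) `^ b = a.
  by rewrite -powRrM mulVf ?gt_eqF// powRr1.
have lt u v : 0 <= u -> 0 <= v -> u < v -> u `^ b < v `^ b.
  by move=> u0 v0; apply: gt0_ltr_powR; rewrite ?nnegrE.
have le u v : 0 <= u -> 0 <= v -> u <= v -> u `^ b <= v `^ b.
  by move=> u0 v0; apply: ge0_ler_powR; rewrite ?nnegrE// ltW.
have r0 : 0 <= a `^ b^-1 := powR_ge0 _ _.
split.
- have [h|h] := ltP (a `^ b^-1) x; first by rewrite -{1}aE lt.
  by rewrite -{1}aE; apply/esym/negbTE; rewrite -leNgt le.
- have [h|h] := leP (a `^ b^-1) x; first by rewrite -{1}aE le.
  by rewrite -{1}aE; apply/esym/negbTE; rewrite -ltNge lt.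
Qed.

Variable alpha : nat -> R.
Hypotheses (alpha_ge0 : forall i, 0 <= alpha i) (alpha0 : alpha 0%N = 0).
Local Notation V := (linType (power_system alpha)).
Variable L : {scalar V}.

(** For [y = x ^ b] with [b > 0], the averages over [j < N] of the indicators of
[y > j / N] and of [y >= j / N] lie between [y] and [y + 1 / N]. These indicators are
those of half-lines in [x], whose measures enclose the values of the extended
functional; so the integral of [y] and the value of [L] differ by at most [c / N],
where [c] is the value of [L] at the constant 1. *)
Lemma psd_moment :
  (forall p : V, {in `[0, 1], forall x, 0 <= p x} -> 0 <= L p) -> moment_functional L.
Proof.
move=> Lpos.
pose D : set R := `[0, 1]%classic.
pose G0 : set ((R -> R) * R) := [set hu | exists p : V, hu = (p : R -> R, L p)].
have pG0 : positive_graph D G0.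
  split.
  - by exists 0; rewrite linear0.
  - by move=> a _ _ _ _ [p [-> ->]] [q [-> ->]]; exists (a *: p + q); rewrite linearP.
  - by move=> _ _ [p [-> ->]]; exact: Lpos.
pose c := L (mono alpha 0).
have G0L (p : V) : G0 (p : R -> R, L p) by exists p.
have power1 x : D x -> mono alpha 0 x = 1 by move=> x01; exact: one_eltE.
have power1_ge1 x : D x -> 1 <= mono alpha 0 x by move=> /power1 ->.
have [G [pG G0G Gb]] := positive_extension pG0 (G0L (mono alpha 0)) power1_ge1.
have GL (p : V) : G (p : R -> R, L p) by apply: G0G.
have /choice[T TP] : forall a, exists u, G (\1_(`]a, +oo[%classic : set R), u).
  move=> a; apply: (Gb _ 1) => x _.
  by rewrite indicE ger0_norm ?ler0n// lern1 leq_b1.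
have T0c a : 0 <= T a <= c.
  have [Gz _ _] := pG; apply/andP; split.
    by apply: (positive_graph_le pG Gz (TP a)) => x _; rewrite indicE ler0n.
  apply: (positive_graph_le pG (TP a) (GL _)) => x Dx.
  by rewrite power1// indicE lern1 leq_b1.
have Tni a b : a <= b -> T b <= T a.
  move=> ab; apply: (positive_graph_le pG (TP b) (TP a)) => x _.
  rewrite !indicE ler_nat !mem_setE !in_itv /= !andbT.
  by case: (ltP b x) => // /(le_lt_trans ab) ->.
have c0 : 0 <= c by have /andP[] := T0c 0; exact: le_trans.
have [mu [muD muo muc]] := quantile_measure Tni T0c.
have mI : measurable I01 by exact: measurable_itv.
have mpow (b : R) : measurable_fun I01 (fun x => (x `^ b)%:E).
  apply/measurable_EFinP; apply: measurable_funTS.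
  exact: measurable_realfun.measurable_powR.
have mono_int i : (\int[mu]_(x in I01) (x `^ alpha i)%:E = (L (mono alpha i))%:E)%E.
  have monoE x : D x -> mono alpha i x = x `^ alpha i.
    by move=> Dx; rewrite /= patchE mem_setE Dx.
  have := alpha_ge0 i; rewrite le_eqVlt => /predU1P[b0|b0].
    rewrite -b0; under eq_integral do rewrite powRr0.
    rewrite integral_cst// mul1e muD; congr (_%:E).
    apply/eqP; rewrite eq_le; apply/andP; split.
      by apply: (positive_graph_le pG (GL _) (GL _)) => x Dx; rewrite power1// monoE// -b0 powRr0.
    by apply: (positive_graph_le pG (GL _) (GL _)) => x Dx; rewrite power1// monoE// -b0 powRr0.
  set b := alpha i in b0 monoE *; set l := L _.
  (* [A] is the value of the extended functional at the average of open steps. *)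
  have key (N : nat) : exists A : R, [/\ l <= A, A <= l + c / N.+1%:R,
      (\int[mu]_(x in I01) (x `^ b)%:E <= A%:E)%E &
      (A%:E <= \int[mu]_(x in I01) (x `^ b)%:E + (c / N.+1%:R)%:E)%E].
    pose w : R := N.+1%:R^-1.
    have w0 : 0 < w by rewrite invr_gt0.
    pose a (j : nat) : R := (w * j%:R) `^ b^-1.
    have a0 j : 0 <= a j by exact: powR_ge0.
    have a1 (j : 'I_N.+1) : a j <= 1.
      rewrite (powR_lt_root b0)// ?mulr_ge0 ?(ltW w0)// powR1.
      by rewrite ler_pdivrMl// mulr1 ler_nat ltnW.
    pose lo (x : R) : R := \sum_(j < N.+1) w * \1_(`]a j, +oo[%classic : set R) x.
    pose up (x : R) : R := \sum_(j < N.+1) w * \1_(`[a j, +oo[%classic : set R) x.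
    have y01 x : D x -> 0 <= x `^ b <= 1.
      rewrite /D /= in_itv /= => /andP[x0 x1]; rewrite powR_ge0 /=.
      have p1 : (1 : R) `^ b = 1 by rewrite powR1.
      by rewrite -p1 ge0_ler_powR ?nnegrE ?(ltW b0).
    have loE x : D x -> lo x = w * \sum_(j < N.+1) (j%:R < N.+1%:R * x `^ b)%R%:R.
      rewrite /D /= in_itv /= => /andP[x0 x1]; rewrite mulr_sumr; apply: eq_bigr => j _.
      rewrite indicE mem_setE in_itv /= andbT (powR_lt_root b0)// ?mulr_ge0 ?(ltW w0)//.
      by rewrite ltr_pdivrMl.
    have upE x : D x -> up x = w * \sum_(j < N.+1) (j%:R <= N.+1%:R * x `^ b)%R%:R.
      rewrite /D /= in_itv /= => /andP[x0 x1]; rewrite mulr_sumr; apply: eq_bigr => j _.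
      rewrite indicE mem_setE in_itv /= andbT (powR_lt_root b0)// ?mulr_ge0 ?(ltW w0)//.
      by rewrite ler_pdivrMl.
    have le_lo x : D x -> x `^ b <= lo x.
      move=> Dx; have /andP[y0 y1] := y01 x Dx.
      rewrite loE// ler_pdivlMl// count_lt// ?mulr_ge0//.
      by rewrite ler_piMr.
    have up_le x : D x -> up x <= x `^ b + w.
      move=> Dx; have /andP[y0 y1] := y01 x Dx.
      rewrite upE// ler_pdivrMl// mulrDr mulfV// count_le// mulr_ge0//.
    have lo_up x : lo x <= up x.
      apply: ler_sum => j _; rewrite ler_wpM2l ?(ltW w0)// !indicE ler_nat !mem_setE.
      by rewrite !in_itv /= !andbT; case: (ltP (a j) x) => // /ltW ->.
    have GA : G (lo, \sum_(j < N.+1) w * T (a j)).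
      rewrite (_ : lo = \sum_(j < N.+1) w \*: \1_(`]a j, +oo[%classic : set R)).
        by apply: (positive_graph_sum pG) => j; exact: (positive_graph_Z _ pG (TP _)).
      by apply/funext => x; rewrite fct_sumE.
    exists (\sum_(j < N.+1) w * T (a j)); split.
    - by apply: (positive_graph_le pG (GL _) GA) => x Dx; rewrite monoE// le_lo.
    - apply: (positive_graph_le pG GA (v := l + c * w)
        (positive_graph_D pG (GL (mono alpha i)) (g := w \*: (mono alpha 0 : R -> R)) _)).
        by rewrite mulrC; exact: (positive_graph_Z _ pG (GL _)).
      move=> x Dx; rewrite (le_trans (lo_up x))// (le_trans (up_le _ Dx))//.
      by rewrite -[leRHS]/(_ + w * _) power1// mulr1 monoE.
    - have step : (\int[mu]_(x in I01) (x `^ b)%:E <= \int[mu]_(x in I01) (lo x)%:E)%E.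
        apply: ge0_le_integral => //.
        + by move=> x _; rewrite lee_fin powR_ge0.
        + apply/measurable_EFinP; apply: measurable_sum => j.
          by apply: measurable_funM => //; apply: measurable_indic; exact: measurable_itv.
      apply: (le_trans step); rewrite /lo (integral_steps mu (ltW w0)) => [|j].
        2: exact: measurable_itv.
      rewrite -sumEFin lee_sum// => j _; rewrite EFinM lee_wpmul2l ?lee_fin ?(ltW w0)//.
      exact: muo.
    - have step : (\int[mu]_(x in I01) (up x)%:E <=
          \int[mu]_(x in I01) ((x `^ b)%:E + w%:E))%E.
        apply: ge0_le_integral => //.
        + move=> x _; rewrite lee_fin sumr_ge0// => j _.
          by rewrite mulr_ge0 ?(ltW w0)// indicE.
        + apply/measurable_EFinP; apply: measurable_sum => j.
          by apply: measurable_funM => //; apply: measurable_indic; exact: measurable_itv.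
        + exact: emeasurable_funD.
      rewrite ge0_integralD// ?integral_cst// in step; last 2 first.
      + by move=> x _; rewrite lee_fin powR_ge0.
      + by move=> x _; rewrite lee_fin ltW.
      rewrite muD -EFinM mulrC in step.
      apply: le_trans step; rewrite /up (integral_steps mu (ltW w0)) => [|j].
        2: exact: measurable_itv.
      rewrite -sumEFin lee_sum// => j _; rewrite EFinM lee_wpmul2l ?lee_fin ?(ltW w0)//.
      exact: muc.
  have small (e : R) : 0 < e -> exists N : nat, c / N.+1%:R <= e.
    move=> e0; exists (Num.truncn (c / e)).
    by rewrite ler_pdivrMr// mulrC -ler_pdivrMr// ltW// truncnS_gt.
  apply/eqP; rewrite eq_le; apply/andP; split; apply/lee_addgt0Pr => e e0;
    have [N Ne] := small e e0; have [A [lA Al IA AI]] := key N.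
  - by rewrite (le_trans IA)// -EFinD lee_fin (le_trans Al)// lerD2l.
  - rewrite (le_trans _ (le_trans AI _)) ?lee_fin// leeD2l// lee_fin//.
exists mu => f.
have mono_intg i : mu.-integrable I01 (fun x => (x `^ alpha i)%:E).
  apply/integrableP; split => //.
  under eq_integral do rewrite gee0_abs ?lee_fin ?powR_ge0//.
  by rewrite mono_int ltry.
have [N /(_ N (leqnn N))[d ->]] := span_eltP f.
rewrite (@eq_integral _ _ _ _ _ (fun x : measurableTypeR R =>
    \sum_(j < N) ((d j)%:E * (x `^ alpha j)%:E))%E); last first.
  by move=> x; rewrite inE /= => x01; rewrite span_eltE// /gpoly -sumEFin.
rewrite integral_sum//; last by move=> j; exact: integrableZl.
rewrite /span_elt linear_sum -sumEFin; apply: eq_bigr => j _.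
by rewrite integralZl// mono_int linearZ.
Qed.

End Moment.

(** * The equivalence *)

Section Chain.
Variables (R : realType) (alpha : nat -> R).
Hypotheses (alpha_ge0 : forall i, 0 <= alpha i) (alpha0 : alpha 0%N = 0).
Hypothesis alpha_lt : {homo alpha : i j / (i < j)%N >-> i < j}.
Local Notation V := (linType (power_system alpha)).
Variable L : {scalar V}.

Lemma moment_psd : moment_functional L ->
  forall p : V, {in `[0, 1], forall x, 0 <= p x} -> 0 <= L p.
Proof.
move=> [mu muL] p p0; rewrite -lee_fin -muL; apply: integral_ge0 => x x01.
by rewrite lee_fin p0.
Qed.

(** A small positive constant added to a nonnegative [p] makes it positive. *)
Lemma psd_of_pd : (forall p : V, {in `[0, 1], forall x, 0 < p x} -> 0 <= L p) ->
  forall p : V, {in `[0, 1], forall x, 0 <= p x} -> 0 <= L p.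
Proof.
move=> Lpd p p0.
have one01 := @one_eltE R alpha alpha0.
have L1 : 0 <= L (mono alpha 0) by apply: Lpd => x x01; rewrite one01.
have L11 : 0 < L (mono alpha 0) + 1 by rewrite ltr_wpDl.
apply/ler_addgt0Pr => e e0; pose d := e / (L (mono alpha 0) + 1).
have d0 : 0 < d by rewrite divr_gt0.
have : 0 <= L (d *: mono alpha 0 + p).
  apply: Lpd => x x01; rewrite -[ltRHS]/(d * mono alpha 0 x + p x) one01// mulr1.
  by rewrite ltr_pwDl ?p0.
rewrite linearP /= => /le_trans; apply; rewrite addrC lerD2l.
by rewrite /d mulrAC ler_pdivrMr// ler_pM2l// lerDl.
Qed.

Lemma node_dets_ge0 (xs : seq R) (p : V) : path <%R 0 (rcons xs 1) ->
    [\/ {in `[0, 1], forall x, p x =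
          \det (node_mx (2 * size xs).+1 (fun i t => t `^ alpha i)
            (pt x ++ flatten (map (@dbl R) xs)))},
        {in `[0, 1], forall x, p x =
          \det (node_mx (2 * size xs).+2 (fun i t => t `^ alpha i.+1)
            (pt x ++ flatten (map (@dbl R) xs) ++ pt 1))},
        {in `[0, 1], forall x, p x =
          \det (node_mx (2 * size xs).+1 (fun i t => t `^ alpha i.+1)
            (pt x ++ flatten (map (@dbl R) xs)))} |
        {in `[0, 1], forall x, p x =
          \det (node_mx (2 * size xs).+2 (fun i t => t `^ alpha i)
            (pt x ++ flatten (map (@dbl R) xs) ++ pt 1))}] ->
  {in `[0, 1], forall x, 0 <= p x}.
Proof.
move=> pxs pE; apply: span_ge0_at0 => // x x0 x1.
have x01 : x \in `[0, 1] by rewrite in_itv /= ltW.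
have alpha_lt1 : {homo (alpha \o succn) : i j / (i < j)%N >-> i < j}.
  by move=> i j ij; apply: alpha_lt.
have ge0 b e : {homo b : i j / (i < j)%N >-> i < j} -> 0 <=
    \det (node_mx ((2 * size xs).+1 + nat_of_bool e) (fun i t => t `^ b i)
      (pt x ++ flatten (map (@dbl R) xs) ++ end_row R e)).
  by move=> b_lt; exact: point_row_det_ge0.
case: pE => -> //.
- by have := ge0 _ false alpha_lt; rewrite addn0 cats0.
- by have := ge0 _ true alpha_lt1; rewrite addn1.
- by have := ge0 _ false alpha_lt1; rewrite addn0 cats0.
- by have := ge0 _ true alpha_lt; rewrite addn1.
Qed.

End Chain.

Theorem theorem5p2p5 (R : realType) (alpha : nat -> R)
    (alpha_ge0 : forall i, 0 <= alpha i)
    (alpha0 : alpha 0%N = 0)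
    (alpha_lt : forall i, alpha i < alpha i.+1)
    (alpha_div : (\sum_(1 <= i <oo) ((alpha i)^-1)%:E = +oo)%E)
    (L : {scalar linType (power_system alpha)}) :
  [<->
    (* (i) *)
    moment_functional L;
    (* (ii) *)
    forall p : linType (power_system alpha),
      {in `[0, 1], forall x, 0 <= p x} -> 0 <= L p;
    (* (iii) *)
    forall p : linType (power_system alpha),
      {in `[0, 1], forall x, 0 < p x} -> 0 <= L p;
    (* (iv) *)
    forall (m : nat) (xs : m.-tuple R), (0 < m)%N ->
      path <%R 0 (rcons xs 1) ->
      forall p : linType (power_system alpha),
      [\/ {in `[0, 1], forall x, p x =
            \det (node_mx (2 * m).+1 (fun i t => t `^ alpha i)
              (pt x ++ flatten (map (@dbl R) xs)))},
          {in `[0, 1], forall x, p x =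
            \det (node_mx (2 * m) (fun i t => t `^ alpha i.+1)
              (pt x ++ flatten (map (@dbl R) (take m.-1 xs)) ++ pt 1))},
          {in `[0, 1], forall x, p x =
            \det (node_mx (2 * m).+1 (fun i t => t `^ alpha i.+1)
              (pt x ++ flatten (map (@dbl R) xs)))} |
          {in `[0, 1], forall x, p x =
            \det (node_mx (2 * m).+2 (fun i t => t `^ alpha i)
              (pt x ++ flatten (map (@dbl R) xs) ++ pt 1))}] ->
      0 <= L p].
Proof.
have alpha_homo : {homo alpha : i j / (i < j)%N >-> i < j}.
  by apply: homo_ltn => //; exact: lt_trans.
tfae.
- exact: moment_psd.
- by move=> Lpsd p p0; apply: Lpsd => x x01; rewrite ltW ?p0.
- move=> Lpd m xs m0 pxs p pE; apply: (psd_of_pd alpha0 Lpd).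
  have szx : size xs = m by rewrite size_tuple.
  case: pE => pE.
  + by apply: (node_dets_ge0 alpha_ge0 alpha_homo pxs); constructor 1; rewrite szx.
  + have ptake : path <%R 0 (rcons (take m.-1 xs) 1).
      move: pxs; rewrite !path_rcons01 => /and3P[xs0 xs1 srt]; apply/and3P; split.
      * by apply/allP => y /mem_take /(allP xs0).
      * by apply/allP => y /mem_take /(allP xs1).
      * exact: take_sorted.
    apply: (node_dets_ge0 alpha_ge0 alpha_homo ptake); constructor 2.
    rewrite size_takel ?szx ?leq_pred//.
    have -> : (2 * m.-1).+2 = (2 * m)%N by rewrite -(prednK m0); lia.
    exact: pE.
  + by apply: (node_dets_ge0 alpha_ge0 alpha_homo pxs); constructor 3; rewrite szx.
  + by apply: (node_dets_ge0 alpha_ge0 alpha_homo pxs); constructor 4; rewrite szx.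
- move=> Ldets; apply: psd_moment => //.
  apply: psd_of_determinants => //.
  + move=> xs p xs0 pxs pE.
    by apply: (Ldets (size xs) (in_tuple xs) xs0 pxs p); constructor 1.
  + move=> xs y p pxs pE.
    apply: (Ldets (size xs).+1 (tcast (size_rcons xs y) (in_tuple (rcons xs y)))) => //.
      by rewrite val_tcast.
    constructor 2 => x x01; rewrite pE// /upper_det val_tcast /= -cats1 take_size_cat//.
    by rewrite mulnS.
Qed.
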